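(* Suppose Assumption A (constant $d$), Assumption E and Assumption O hold, and let $\epsilon_\theta\in(0,1)$ be such that $m^\circ_\epsilon\le G_\epsilon$ for all $\epsilon\in(0,\epsilon_\theta)$. If in addition $\log(G_\epsilon/\Phi^\circ_\epsilon)/m^\circ_\epsilon\to0$ as $\epsilon\to0$, then there exists a constant $K<\infty$ depending only on $\theta^\circ,\eta,\lambda,d$ such that the Bayes estimator $\hat\theta=\mathbb E[\vartheta^M|Y]$ satisfies $\mathbb E_{\theta^\circ}\|\hat\theta-\theta^\circ\|^2\le K\,\Phi^\circ_\epsilon$ for all $\epsilon\in(0,\epsilon_\theta)$.
   Context: Let $\ell^2$ be the space of square-summable real sequences with norm $\|\cdot\|$. Fix a bounded real sequence $\lambda=(\lambda_j)_{j\ge1}$ with $\lambda_j\ne0$ for all $j$, a noise level $\epsilon\in(0,1)$ and a true parameter $\theta^\circ\in\ell^2$. The data $Y=(Y_j)_{j\ge1}$ satisfy $Y_j=\lambda_j\theta^\circ_j+\sqrt\epsilon\,\xi_j$ with $\xi_j$ i.i.d. $N(0,1)$; $\mathbb E_{\theta^\circ}$ denotes expectation under this law. Fix prior means $\eta=(\eta_j)_{j\ge1}$ with $\theta^\circ-\eta\in\ell^2$ and prior variances $\tau_j\in(0,\infty)$ (possibly depending on $\epsilon$). Put $\sigma_j:=(\lambda_j^2\epsilon^{-1}+\tau_j^{-1})^{-1}$, $\theta^Y_j:=\sigma_j(\tau_j^{-1}\eta_j+\lambda_j\epsilon^{-1}Y_j)$, $\hat\theta^m_j:=\theta^Y_j$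 for $j\le m$, $\hat\theta^m_j:=\eta_j$ for $j>m$. Define $b_m:=\sum_{j>m}(\theta^\circ_j-\eta_j)^2$, $\Lambda_j:=\lambda_j^{-2}$, $\Lambda_{(m)}:=\max_{1\le j\le m}\Lambda_j$, $\bar\Lambda_m:=m^{-1}\sum_{j=1}^m\Lambda_j$, $\Phi^m_\epsilon:=b_m\vee\epsilon m\bar\Lambda_m$, $m^\circ_\epsilon:=\min\{m\ge1:\Phi^m_\epsilon\le\Phi^k_\epsilon\ \forall k\ge1\}$, $\Phi^\circ_\epsilon:=\min_{m\ge1}\Phi^m_\epsilon$. Let $G_\epsilon:=\max\{1\le m\le\lfloor\epsilon^{-1}\rfloor:\epsilon\Lambda_{(m)}\le\Lambda_1\}$. Assumption A: there is $d>0$ with $\tau_j\ge d\,(\epsilon^{1/2}\Lambda_j^{1/2}\vee\epsilon\Lambda_j)$ for all $1\le j\le G_\epsilon$, $\epsilon\in(0,1)$. Assumption E: there are constants $C_\lambda\ge1$, $L_\lambda\ge1$ such that for all $k,l\in\mathbb N$: (i) $\sup_{j>k}\lambda_j^2\le C_\lambda\min_{1\le j\le k}\lambda_j^2=C_\lambda\Lambda_{(k)}^{-1}$; (ii) $\Lambda_{(kl)}\le\Lambda_{(k)}\Lambda_{(l)}$; (iii) $\Lambda_{(k)}/\bar\Lambda_k\le L_\lambda$. Fix $\epsilon_o\in(0,1)$. Assumption O: $\kappa^\circ:=\inf_{0<\epsilon<\epsilon_o}(\Phi^\circ_\epsilon)^{-1}[b_{m^\circ_\epsilon}\wedge\epsilon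 m^\circ_\epsilon\bar\Lambda_{m^\circ_\epsilon}]>0$. Hierarchical prior: a random dimension $M$ with values in $\{1,\dots,G_\epsilon\}$ and $P(M=m)\propto\exp(-3C_\lambda m/2)\prod_{j=1}^m(\tau_j/\sigma_j)^{1/2}$; conditionally on $M=m$ the parameter $\vartheta^M$ has independent coordinates $N(\eta_j,\tau_j)$ for $j\le m$ and equal to $\eta_j$ for $j>m$, and $Y_j=\lambda_j\vartheta^M_j+\sqrt\epsilon\xi_j$. The posterior of $M$ is $P_{M|Y}(M=m)=\exp(\frac12\{\|\hat\theta^m-\eta\|_\sigma^2-3C_\lambda m\})/\sum_{k=1}^{G_\epsilon}\exp(\frac12\{\|\hat\theta^k-\eta\|_\sigma^2-3C_\lambda k\})$ with $\|x\|_\sigma^2:=\sum_j x_j^2/\sigma_j$. The Bayes estimator $\hat\theta:=\mathbb E[\vartheta^M|Y]$ is given by $\hat\theta_j=\eta_j P_{M|Y}(1\le M<j)+\theta^Y_jP_{M|Y}(j\le M\le G_\epsilon)$ for $1\le j\le G_\epsilon$ and $\hat\theta_j=\eta_j$ for $j>G_\epsilon$. *)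

(* Defs.v *)
From HB Require Import structures.
From mathcomp Require Import all_boot all_order all_algebra.
From mathcomp Require Import all_classical all_reals all_analysis.
Set Implicit Arguments. Unset Strict Implicit. Unset Printing Implicit Defensive.
Import Order.TTheory GRing.Theory Num.Theory.
Import numFieldNormedType.Exports.
Local Open Scope classical_set_scope.
Local Open Scope ring_scope.

(* All sequences are maps nat -> R; only indices j >= 1 are used (index 0 is
   ignored), matching the paper's indexing j = 1, 2, ... *)

Section defs.
Variable R : realType.

Definition Lam (lam : nat -> R) (j : nat) : R := (lam j ^+ 2)^-1.
Definition Lmax (lam : nat -> R) (m : nat) : R :=
  \big[Num.max/0]_(1 <= j < m.+1) Lam lam j.
Definition Lbar (lam : nat -> R) (m : nat) : R :=
  (m%:R)^-1 * \sum_(1 <= j < m.+1) Lam lam j.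
Definition bias (th eta : nat -> R) (m : nat) : R :=
  limn (fun n => \sum_(m.+1 <= j < n) (th j - eta j) ^+ 2).
Definition Phi (th eta lam : nat -> R) (eps : R) (m : nat) : R :=
  Num.max (bias th eta m) (eps * m%:R * Lbar lam m).
Definition is_mo (th eta lam : nat -> R) (eps : R) (m : nat) : Prop :=
  [/\ (1 <= m)%N,
      (forall k, (1 <= k)%N -> Phi th eta lam eps m <= Phi th eta lam eps k) &
      (forall m', (1 <= m')%N ->
         (forall k, (1 <= k)%N -> Phi th eta lam eps m' <= Phi th eta lam eps k) ->
         (m <= m')%N)].
Definition mo (th eta lam : nat -> R) (eps : R) : nat :=
  xget 1%N [set m | is_mo th eta lam eps m].
Definition Phio (th eta lam : nat -> R) (eps : R) : R :=
  inf [set Phi th eta lam eps m | m in [set m : nat | (1 <= m)%N]].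
Definition Geps (lam : nat -> R) (eps : R) : nat :=
  \max_(1 <= m < (Num.truncn (eps^-1)).+1 | eps * Lmax lam m <= Lam lam 1) m.

Definition AssumptionA (lam : nat -> R) (tau : R -> nat -> R) (d : R) : Prop :=
  forall eps, 0 < eps < 1 -> forall j, (1 <= j <= Geps lam eps)%N ->
    d * Num.max (Num.sqrt eps * Num.sqrt (Lam lam j)) (eps * Lam lam j)
      <= tau eps j.

Definition AssumptionE (lam : nat -> R) (Cl Ll : R) : Prop :=
  [/\ 1 <= Cl, 1 <= Ll &
      forall k l, (1 <= k)%N -> (1 <= l)%N ->
      [/\
          (forall j i, (k < j)%N -> (1 <= i <= k)%N -> lam j ^+ 2 <= Cl * lam i ^+ 2),
          Lmax lam (k * l) <= Lmax lam k * Lmax lam l &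
          Lmax lam k / Lbar lam k <= Ll]].

Definition AssumptionO (th eta lam : nat -> R) (eps_o : R) : Prop :=
  0 < inf [set (Phio th eta lam e)^-1 *
               Num.min (bias th eta (mo th eta lam e))
                 (e * (mo th eta lam e)%:R * Lbar lam (mo th eta lam e))
          | e in `]0, eps_o[].

Definition dataY (th lam : nat -> R) (eps : R) (xi : nat -> R) (j : nat) : R :=
  lam j * th j + Num.sqrt eps * xi j.
Definition sig (lam : nat -> R) (tau : nat -> R) (eps : R) (j : nat) : R :=
  (lam j ^+ 2 / eps + (tau j)^-1)^-1.
Definition thY (eta lam tau : nat -> R) (eps : R) (Y : nat -> R) (j : nat) : R :=
  sig lam tau eps j * ((tau j)^-1 * eta j + lam j / eps * Y j).
(* ||hat theta^m - eta||_sigma^2 ; the coordinates j > m vanish *)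
Definition normsig (eta lam tau : nat -> R) (eps : R) (Y : nat -> R) (m : nat) : R :=
  \sum_(1 <= j < m.+1) (thY eta lam tau eps Y j - eta j) ^+ 2 / sig lam tau eps j.
Definition postw (eta lam tau : nat -> R) (Cl eps : R) (Y : nat -> R) (m : nat) : R :=
  expR ((normsig eta lam tau eps Y m - 3 * Cl * m%:R) / 2).
Definition post (eta lam tau : nat -> R) (Cl eps : R) (Y : nat -> R) (m : nat) : R :=
  postw eta lam tau Cl eps Y m /
  \sum_(1 <= k < (Geps lam eps).+1) postw eta lam tau Cl eps Y k.
Definition bayes (eta lam tau : nat -> R) (Cl eps : R) (Y : nat -> R) (j : nat) : R :=
  if (1 <= j <= Geps lam eps)%N then
    eta j * (\sum_(1 <= m < j) post eta lam tau Cl eps Y m)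
    + thY eta lam tau eps Y j *
        (\sum_(j <= m < (Geps lam eps).+1) post eta lam tau Cl eps Y m)
  else eta j.

Definition loss (th eta lam tau : nat -> R) (Cl eps : R) (xi : nat -> R) : \bar R :=
  (\sum_(1 <= j <oo) ((bayes eta lam tau Cl eps (dataY th lam eps xi) j - th j) ^+ 2)%:E)%E.

(* Gaussian expectation over the coordinates xi_1, ..., xi_n (i.i.d. N(0,1)),
   as an iterated integral; the other coordinates are set to 0. *)
Definition upd (xi : nat -> R) (i : nat) (x : R) : nat -> R :=
  fun j => if j == i then x else xi j.
Fixpoint Egauss (n : nat) (f : (nat -> R) -> \bar R) : \bar R :=
  match n with
  | 0%N => f (fun _ => 0)
  | n'.+1 => (\int[normal_prob 0 1]_x Egauss n' (fun xi => f (upd xi n x)))%E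
  end.

(* E_{theta°} ||hat theta - theta°||^2 ; the loss depends only on xi_1..xi_{G_eps} *)
Definition risk (th eta lam tau : nat -> R) (Cl eps : R) : \bar R :=
  Egauss (Geps lam eps) (loss th eta lam tau Cl eps).

End defs.

(* Main.v *)
Require Import Defs.
From HB Require Import structures.
From mathcomp Require Import all_boot all_order all_algebra.
From mathcomp Require Import all_classical all_reals all_analysis.
From mathcomp Require Import measurable_realfun ring lra zify.
Import Order.TTheory GRing.Theory Num.Theory.
Import numFieldNormedType.Exports.
Local Open Scope classical_set_scope.
Local Open Scope ring_scope.

(** Write [P_j] for the posterior probability of [M >= j]. Convexity of the
    square gives the pointwise bound
      [loss <= sum_(j <= G) P_j (thY_j - th_j)^2 + sum_(k <= G) post_k bias_k].
    With [m] the oracle dimension, [post_k <= 1] and [post_k <= w_k / w_m], so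
    [post_k <= (w_k / w_m)^(1/8)], and every term is dominated by a multiple of
    [exp (sum_j t_j xi_j^2)] with [t_j <= 1/4], whose Gaussian expectation is
    explicit.
    - For [j <= c m] assumption E bounds the variances by a multiple of the
      oracle rate, and [P_j <= 1] suffices.
    - For [k > c m] the penalty [3 Cl (k - m)] beats the chi-square fluctuations,
      and also the signal beyond [m], which assumptions O and E bound by
      [Cl m / kappa]. This leaves [exp (- 2 m)].
    - For [k < m] with [bias_k > D Phio] the signal between [k] and [m] is at
      least a large multiple of [m], which leaves [exp (- m)].
    The hypothesis [ln (G / Phio) / m --> 0] absorbs the factors [G] for small
    noise. For noise levels bounded away from [0], [Phio] is bounded below and
    [P_j <= 1] is enough. *)

(** * Exponential moments of squares of standard Gaussians under iterated integration *)

Section gaussian_moments.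
Set Implicit Arguments.
Unset Strict Implicit.
Unset Printing Implicit Defensive.
Context {R : realType}.
Local Notation mu := (@lebesgue_measure R).

(** The Radon-Nikodym derivative of the normal law agrees almost everywhere with [normal_pdf], since
    both have the same integral over every measurable set. *)
Lemma ge0_integral_normal_prob (m s : R) (f : R -> \bar R) :
  (forall x, 0 <= f x)%E -> measurable_fun setT f ->
  (\int[normal_prob m s]_x f x = \int[mu]_x (f x * (normal_pdf m s x)%:E))%E.
Proof.
move=> f0 mf.
have dom := normal_prob_dominates m s.
rewrite -(Radon_Nikodym_SigmaFinite.change_of_variables dom)//=.
have mpdf : measurable_fun setT (fun x => (normal_pdf m s x)%:E).
  by apply/measurable_EFinP; exact: measurable_normal_pdf.
have fi := Radon_Nikodym_SigmaFinite.f_integrable dom.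
apply: ae_eq_integral => //.
- by apply: emeasurable_funM => //; exact: (measurable_int mu).
- by apply: emeasurable_funM.
apply: ae_eqe_mul2l; apply: integral_ae_eq => //= E _ mE.
by rewrite -(Radon_Nikodym_SigmaFinite.f_integral dom).
Qed.

(* The integral of a nonnegative function is a supremum over simple functions
   below it, hence monotone even for integrands not known to be measurable; this
   spares the measurability of the loss and of its partial integrals. *)
Lemma ge0_le_integral_nonmeas d (T : measurableType d)
    (m : {measure set T -> \bar R}) (f g : T -> \bar R) :
  (forall x, 0 <= f x)%E -> (forall x, f x <= g x)%E ->
  (\int[m]_x f x <= \int[m]_x g x)%E.
Proof.
move=> f0 fg; rewrite !ge0_integralTE//; last first.
  by move=> x; exact: le_trans (f0 x) (fg x).
apply: le_ereal_sup => _ [h hf <-]; exists h => // x.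
exact: le_trans (hf x) (fg x).
Qed.

Lemma measurable_expR_sqr (t : R) :
  measurable_fun setT (fun x : R => expR (t * x ^+ 2)).
Proof.
apply: measurableT_comp => //; apply: measurable_funM => //.
Qed.

(** Multiplying the standard density by [expR (t * x ^+ 2)] gives [s] times the centred normal
    density of variance [s ^+ 2 = (1 - 2 * t)^-1], so the integral is exactly [s]. As
    [s ^+ 2 = 1 + 2 * (t / (1 - 2 * t))], the inequality [1 + y <= expR y] turns this into an
    exponential, whose exponents add up over coordinates. *)
Lemma normal_expR_sqr_le (t : R) : 0 <= t < 1 / 2 ->
  (\int[normal_prob 0 1]_x (expR (t * x ^+ 2))%:E
     <= (expR (t / (1 - 2 * t)))%:E :> \bar R)%E.
Proof.
move=> /andP[t0 t12].
have q0 : 0 < 1 - 2 * t by lra.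
pose s : R := Num.sqrt (1 - 2 * t)^-1.
have s2 : s ^+ 2 = (1 - 2 * t)^-1 by rewrite sqr_sqrtr// invr_ge0 ltW.
have s0 : 0 < s by rewrite sqrtr_gt0 invr_gt0.
rewrite ge0_integral_normal_prob; last 2 first.
  by move=> x; rewrite lee_fin expR_ge0.
  by apply/measurable_EFinP; exact: measurable_expR_sqr.
have -> : (\int[mu]_x ((expR (t * x ^+ 2))%:E * (normal_pdf 0 1 x)%:E)
    = \int[mu]_x (s%:E * (normal_pdf 0 s x)%:E) :> \bar R)%E.
  apply: eq_integral => x _; rewrite -!EFinM; congr EFin.
  rewrite !normal_pdfE ?oner_eq0 ?gt_eqF// /normal_fun /normal_peak !subr0.
  rewrite mulrCA -expRD.
  have -> : t * x ^+ 2 + - x ^+ 2 / (1 ^+ 2 *+ 2) = - x ^+ 2 / (s ^+ 2 *+ 2).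
    rewrite s2; field.
    by rewrite gt_eqF.
  rewrite mulrA; congr *%R.
  rewrite -!mulrnAr expr1n mul1r (sqrtrM (pi *+ 2)) ?sqr_ge0// sqrtr_sqr gtr0_norm//.
  rewrite invfM mulrA divff ?gt_eqF// mul1r//.
rewrite ge0_integralZl//; last 3 first.
- by apply/measurable_EFinP; exact: measurable_normal_pdf.
- by move=> x _; rewrite lee_fin normal_pdf_ge0.
- by rewrite lee_fin ltW.
rewrite integral_normal_pdf mule1 lee_fin.
rewrite -(@ler_pXn2r _ 2) ?nnegrE ?expR_ge0 ?(ltW s0)// s2.
have -> : expR (t / (1 - 2 * t)) ^+ 2 = expR (2 * (t / (1 - 2 * t))).
  by rewrite expr2 -expRD -mulr2n [2 * (_ / _)]mulr_natl.
have {1}-> : (1 - 2 * t)^-1 = 1 + 2 * (t / (1 - 2 * t)) by field; rewrite gt_eqF.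
exact: expR_ge1Dx.
Qed.

Lemma Egauss_ge0 n (f : (nat -> R) -> \bar R) :
  (forall xi, 0 <= f xi)%E -> (0 <= Egauss n f)%E.
Proof.
elim: n f => [|n IH] f f0 /=; first exact: f0.
by apply: integral_ge0 => x _; apply: IH => xi; exact: f0.
Qed.

Lemma Egauss_le_expR_sqr (I : Type) (s : seq I) n (f : (nat -> R) -> \bar R)
    (c : I -> R) (t : I -> nat -> R) :
  (forall i, 0 <= c i) -> (forall i j, 0 <= t i j < 1 / 2) ->
  (forall xi, 0 <= f xi)%E ->
  (forall xi, f xi <=
     (\sum_(i <- s) c i * expR (\sum_(1 <= j < n.+1) t i j * xi j ^+ 2))%:E)%E ->
  (Egauss n f <=
     (\sum_(i <- s) c i *
        expR (\sum_(1 <= j < n.+1) t i j / (1 - 2 * t i j)))%:E)%E.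
Proof.
elim: n f c => [|n IH] f c c0 t0 f0 fle /=.
  apply: le_trans (fle _) _; rewrite lee_fin le_eqVlt; apply/orP; left.
  by apply/eqP/eq_bigr => i _; rewrite !big_geq.
pose e i := expR (\sum_(1 <= j < n.+1) t i j / (1 - 2 * t i j)).
(* With the last coordinate frozen at [x], its exponential factor is a constant and joins the
   coefficient [c i]; this is why the induction is over all [c]. *)
have H x : (Egauss n (fun xi => f (upd xi n.+1 x)) <=
    \sum_(i <- s) (c i * e i)%:E * (expR (t i n.+1 * x ^+ 2))%:E)%E.
  have := IH (fun xi => f (upd xi n.+1 x))
    (fun i => c i * expR (t i n.+1 * x ^+ 2)).
  move=> /(_ _ t0 _ _)/le_trans; apply.
  - by move=> i; rewrite mulr_ge0// expR_ge0.
  - by move=> xi; exact: f0.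
  - move=> xi; apply: le_trans (fle _) _; rewrite lee_fin le_eqVlt.
    apply/orP; left; apply/eqP/eq_bigr => i _.
    rewrite big_nat_recr//= expRD mulrA mulrAC /upd eqxx; congr (_ * _ * expR _).
    apply: eq_big_nat => j /andP[_ jn].
    by rewrite ifF//; apply/eqP => jE; rewrite jE ltnn in jn.
  rewrite sumEFin lee_fin le_eqVlt; apply/orP; left; apply/eqP.
  by apply: eq_bigr => i _; rewrite mulrAC.
apply: (@le_trans _ _ (\int[normal_prob 0 1]_x
    \sum_(i <- s) (c i * e i)%:E * (expR (t i n.+1 * x ^+ 2))%:E)%E).
  apply: ge0_le_integral_nonmeas => // x.
  by apply: Egauss_ge0 => xi; exact: f0.
have ce0 i : 0 <= c i * e i by rewrite mulr_ge0// expR_ge0.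
have me i : measurable_fun setT (fun x : R => (expR (t i n.+1 * x ^+ 2))%:E).
  by apply/measurable_EFinP; exact: measurable_expR_sqr.
rewrite ge0_integral_sum//; last 2 first.
- move=> i; apply: (measurable_funeM (c i * e i)%:E
    (f := fun x : R => (expR (t i n.+1 * x ^+ 2))%:E)); exact: me.
- by move=> i x _; rewrite mule_ge0// lee_fin ?expR_ge0.
rewrite -sumEFin; apply: lee_sum => i _.
rewrite ge0_integralZl//; last 2 first.
- exact: (me i).
- by rewrite lee_fin.
rewrite [in leRHS]big_nat_recr//= [in leRHS]expRD mulrA [leRHS]EFinM.
apply: lee_wpmul2l; first by rewrite lee_fin.
exact: normal_expR_sqr_le.
Qed.

End gaussian_moments.

(** * Calculus of upper bounds for Gaussian expectations *)

Section gaussian_domination.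
Set Implicit Arguments.
Unset Strict Implicit.
Unset Printing Implicit Defensive.
Context {R : realType}.
Implicit Types (g : (nat -> R) -> R) (v : R).

(* An upper bound [v] on the expectation of [g], witnessed by functions for
   which iterated Gaussian integrals are linear and explicit. *)
Definition gauss_dom n g v := exists (I : Type) (s : seq I) (c : I -> R)
    (t : I -> nat -> R),
  [/\ forall i, 0 <= c i, forall i j, 0 <= t i j < 1 / 2,
      forall xi, g xi <=
        \sum_(i <- s) c i * expR (\sum_(1 <= j < n.+1) t i j * xi j ^+ 2) &
      \sum_(i <- s) c i * expR (\sum_(1 <= j < n.+1) t i j / (1 - 2 * t i j))
        <= v].

Lemma gauss_dom_Egauss n g v (f : (nat -> R) -> \bar R) :
  gauss_dom n g v -> (forall xi, 0 <= f xi)%E -> (forall xi, f xi <= (g xi)%:E)%E ->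
  (Egauss n f <= v%:E)%E.
Proof.
move=> [I [s [c [t [c0 t0 gle vle]]]]] f0 fg.
apply: le_trans (Egauss_le_expR_sqr (s := s) (c := c) (t := t) c0 t0 f0 _) _.
  by move=> xi; apply: le_trans (fg xi) _; rewrite lee_fin.
by rewrite lee_fin.
Qed.

Lemma gauss_dom_le n g g' v v' : (forall xi, g' xi <= g xi) -> v <= v' ->
  gauss_dom n g v -> gauss_dom n g' v'.
Proof.
move=> gg vv [I [s [c [t [c0 t0 gle vle]]]]]; exists I, s, c, t; split => //.
  by move=> xi; exact: le_trans (gg xi) (gle xi).
exact: le_trans vle vv.
Qed.

Lemma gauss_dom_ler n g v v' : v <= v' -> gauss_dom n g v -> gauss_dom n g v'.
Proof. by apply: gauss_dom_le => xi; exact: lexx. Qed.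

Lemma gauss_dom_cst n (k : R) : 0 <= k -> gauss_dom n (fun=> k) k.
Proof.
move=> k0; exists unit, [:: tt], (fun=> k), (fun _ _ => 0); split => //.
- by move=> _ _; rewrite lexx /=; lra.
- move=> xi; rewrite big_seq1 big1 ?expR0 ?mulr1// => j _; exact: mul0r.
- rewrite big_seq1 big1 ?expR0 ?mulr1// => j _; exact: mul0r.
Qed.

Lemma gauss_domZ n g v (k : R) : 0 <= k -> gauss_dom n g v ->
  gauss_dom n (fun xi => k * g xi) (k * v).
Proof.
move=> k0 [I [s [c [t [c0 t0 gle vle]]]]].
exists I, s, (fun i => k * c i), t; split => //.
- by move=> i; exact: mulr_ge0.
- move=> xi; under eq_bigr do rewrite -mulrA.
  by rewrite -mulr_sumr ler_wpM2l.
- under eq_bigr do rewrite -mulrA.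
  by rewrite -mulr_sumr ler_wpM2l.
Qed.

Lemma gauss_domD n g1 g2 v1 v2 : gauss_dom n g1 v1 -> gauss_dom n g2 v2 ->
  gauss_dom n (fun xi => g1 xi + g2 xi) (v1 + v2).
Proof.
move=> [I1 [s1 [c1 [t1 [c10 t10 gle1 vle1]]]]] [I2 [s2 [c2 [t2 [c20 t20 gle2 vle2]]]]].
exists (I1 + I2)%type, (map inl s1 ++ map inr s2),
  (fun i => match i with inl i => c1 i | inr i => c2 i end),
  (fun i => match i with inl i => t1 i | inr i => t2 i end); split.
- by case.
- by case.
- by move=> xi; rewrite big_cat !big_map/= lerD.
- by rewrite big_cat !big_map/= lerD.
Qed.

Lemma gauss_dom_sum n (I : Type) (s : seq I) (P : pred I)
    (g : I -> (nat -> R) -> R) (v : I -> R) :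
  (forall i, P i -> gauss_dom n (g i) (v i)) ->
  gauss_dom n (fun xi => \sum_(i <- s | P i) g i xi) (\sum_(i <- s | P i) v i).
Proof.
move=> H; elim: s => [|i s IH].
  apply: (@gauss_dom_le n (fun=> 0) _ 0); last exact: gauss_dom_cst.
    by move=> xi; rewrite big_nil.
  by rewrite big_nil.
have [Pi|nPi] := boolP (P i); last first.
  apply: gauss_dom_le IH => [xi|]; by rewrite big_cons (negbTE nPi).
apply: gauss_dom_le (gauss_domD (H _ Pi) IH) => [xi|]; by rewrite big_cons Pi.
Qed.

(** The map [t / (1 - 2 * t)] sends [1 / 8] to [1 / 6] and [1 / 4] to [1 / 2]. The distinguished
    index [j] thus adds at most [1 / 3], with equality when it also satisfies [P] and its two
    weights add up to [1 / 4]. *)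
Lemma gauss_dom_expR n (P : pred nat) j : (1 <= j < n.+1)%N ->
  gauss_dom n
    (fun xi => expR (\sum_(1 <= i < n.+1 | P i) xi i ^+ 2 / 8 + xi j ^+ 2 / 8))
    (expR (\sum_(1 <= i < n.+1 | P i) 1 / 6 + 1 / 3)).
Proof.
move=> jn.
pose t i : R := (if P i then 1 / 8 else 0) + (if i == j then 1 / 8 else 0).
have sumj (x : R) : \sum_(1 <= i < n.+1) (if i == j then x else 0) = x.
  by rewrite -big_mkcond big_nat1_eq jn.
exists unit, [:: tt], (fun=> 1), (fun=> t); split => //.
- by move=> _ i; rewrite /t; case: (P i); case: (i == j); lra.
- move=> xi; rewrite big_seq1 mul1r ler_expR le_eqVlt; apply/orP; left.
  apply/eqP; rewrite -{1}(sumj (xi j ^+ 2 / 8)) [X in X + _ = _]big_mkcond -big_split/=.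
  apply: eq_bigr => i _; rewrite /t.
  by have [->|] := eqVneq i j; case: (P _); move=> *; lra.
- rewrite big_seq1 mul1r ler_expR -{1}(sumj (1 / 3)) [X in _ <= X + _]big_mkcond -big_split/=.
  apply: ler_sum => i _; rewrite /t.
  have e1 : ((1 / 8 + 1 / 8) / (1 - 2 * (1 / 8 + 1 / 8)) : R) = 1 / 2 by field.
  have e2 : ((1 / 8 + 0) / (1 - 2 * (1 / 8 + 0)) : R) = 1 / 6 by field.
  have e3 : ((0 + 1 / 8) / (1 - 2 * (0 + 1 / 8)) : R) = 1 / 6 by field.
  by case: (P i); case: (i == j); rewrite ?e1 ?e2 ?e3 ?addr0 ?mul0r; lra.
Qed.

Lemma gauss_dom_sqr n j : (1 <= j < n.+1)%N ->
  gauss_dom n (fun xi => xi j ^+ 2) (8 * expR (1 / 3)).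
Proof.
move=> jn; apply: gauss_dom_le (gauss_domZ (ler0n _ 8) (gauss_dom_expR xpred0 jn)).
  move=> xi; rewrite big_pred0// add0r.
  by have := expR_ge1Dx (xi j ^+ 2 / 8); lra.
by rewrite big_pred0// add0r.
Qed.

End gaussian_domination.

(** * Bounds on posterior weights and loss for a fixed noise sequence *)

Section posterior_bounds.
Set Implicit Arguments.
Unset Strict Implicit.
Unset Printing Implicit Defensive.
Variables (R : realType) (th eta lam tau : nat -> R) (Cl eps : R).
Hypothesis lam0 : forall j, (1 <= j)%N -> lam j != 0.
Hypothesis tau0 : forall j, (1 <= j)%N -> 0 < tau j.
Hypothesis eps0 : 0 < eps.
Implicit Types (xi : nat -> R) (j k m : nat).

Let beta j := th j - eta j.
Let G := Geps lam eps.
Let Y xi := dataY th lam eps xi.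

(* The shrinkage factor 1 / (1 + eps Lambda_j / tau_j) of the conjugate
   Gaussian update, and the standardized bias. *)
Definition shrink j : R := sig lam tau eps j * (lam j ^+ 2 / eps).
Definition zbias j : R := lam j * (th j - eta j) / Num.sqrt eps.

Let sqe : Num.sqrt eps ^+ 2 = eps. Proof. by rewrite sqr_sqrtr// ltW. Qed.
Let sqe0 : Num.sqrt eps != 0. Proof. by rewrite gt_eqF// sqrtr_gt0. Qed.

Lemma Lam_gt0 j : (1 <= j)%N -> 0 < Lam lam j.
Proof. by move=> j1; rewrite invr_gt0 exprn_even_gt0//= lam0. Qed.

Let prec_gt0 j : (1 <= j)%N -> 0 < lam j ^+ 2 / eps + (tau j)^-1.
Proof.
move=> j1; rewrite addr_gt0 ?invr_gt0 ?tau0// divr_gt0//.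
by rewrite exprn_even_gt0//= lam0.
Qed.

Let tau_lam_neq0 j : (1 <= j)%N -> tau j * lam j ^+ 2 + eps != 0.
Proof.
move=> j1; rewrite gt_eqF// addr_gt0// mulr_gt0 ?tau0//.
by rewrite exprn_even_gt0//= lam0.
Qed.

Lemma sig_gt0 j : (1 <= j)%N -> 0 < sig lam tau eps j.
Proof. by move=> j1; rewrite invr_gt0 prec_gt0. Qed.

Lemma shrinkE j : (1 <= j)%N -> shrink j = tau j / (tau j + eps * Lam lam j).
Proof.
move=> j1; have := prec_gt0 j1; rewrite /shrink /sig /Lam => p0.
have l0 := lam0 j1; have t0 := tau0 j1.
by field; rewrite l0 (tau_lam_neq0 j1) !gt_eqF.
Qed.

Lemma shrink_ge0 j : (1 <= j)%N -> 0 <= shrink j.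
Proof.
move=> j1; have := Lam_gt0 j1; have t0 := tau0 j1 => L0.
by rewrite shrinkE// divr_ge0 ?addr_ge0 ?mulr_ge0 ?ltW.
Qed.

Lemma shrink_le1 j : (1 <= j)%N -> shrink j <= 1.
Proof.
move=> j1; have L0 := Lam_gt0 j1; have t0 := tau0 j1.
rewrite shrinkE// ler_pdivrMr ?mul1r ?lerDl ?mulr_ge0 ?ltW//.
by rewrite addr_gt0 ?mulr_gt0.
Qed.

Lemma thY_subE xi j : (1 <= j)%N ->
  thY eta lam tau eps (Y xi) j - eta j =
  shrink j * (beta j + Num.sqrt eps / lam j * xi j).
Proof.
move=> j1; have := prec_gt0 j1; rewrite /thY /Y /dataY /shrink /sig /beta => p0.
have l0 := lam0 j1; have t0 := tau0 j1.
by field; rewrite l0 mulrC (tau_lam_neq0 j1) !gt_eqF.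
Qed.

(** [zbias j + xi j] is the observation centred at the prior mean and scaled to unit variance, so
    [normsig] is a weighted noncentral chi-square sum. *)
Lemma normsig_term xi j : (1 <= j)%N ->
  (thY eta lam tau eps (Y xi) j - eta j) ^+ 2 / sig lam tau eps j =
  shrink j * (zbias j + xi j) ^+ 2.
Proof.
move=> j1; rewrite thY_subE// /shrink /zbias -/(beta j).
have l0 := lam0 j1; have s0 := sig_gt0 j1.
have -> : beta j + Num.sqrt eps / lam j * xi j =
  Num.sqrt eps / lam j * (lam j * beta j / Num.sqrt eps + xi j).
  by field; rewrite l0 sqe0.
set X := lam j * beta j / _ + _; set sg := sig _ _ _ _ in s0 *.
transitivity (sg * (lam j ^+ 2 / eps) * X ^+ 2 * (Num.sqrt eps ^+ 2 / eps)).
  by field; rewrite l0 !gt_eqF.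
by rewrite sqe divff ?mulr1// gt_eqF.
Qed.

Lemma normsig_sub xi k m : (k <= m)%N ->
  normsig eta lam tau eps (Y xi) m - normsig eta lam tau eps (Y xi) k =
  \sum_(k.+1 <= i < m.+1) shrink i * (zbias i + xi i) ^+ 2.
Proof.
move=> km; rewrite /normsig (@big_cat_nat _ _ _ k.+1)//= addrAC subrr add0r.
by apply: eq_big_nat => i /andP[ki _]; rewrite normsig_term//; lia.
Qed.

Let p xi k := post eta lam tau Cl eps (Y xi) k.
Let w xi k := postw eta lam tau Cl eps (Y xi) k.

Let sumw_gt0 xi : (1 <= G)%N -> 0 < \sum_(1 <= k < G.+1) w xi k.
Proof.
move=> G1; rewrite big_ltn// ltr_wpDr ?expR_gt0//.
by apply: sumr_ge0 => i _; exact: expR_ge0.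
Qed.

Lemma post_ge0 xi k : 0 <= p xi k.
Proof.
by rewrite /p /post divr_ge0 ?expR_ge0// sumr_ge0// => i _; exact: expR_ge0.
Qed.

Lemma sum_post xi : (1 <= G)%N -> \sum_(1 <= k < G.+1) p xi k = 1.
Proof. by move=> G1; rewrite -mulr_suml divff// gt_eqF// sumw_gt0. Qed.

Lemma sum_post_le1 xi (P : pred nat) : (1 <= G)%N ->
  \sum_(1 <= k < G.+1 | P k) p xi k <= 1.
Proof.
move=> G1; rewrite -(sum_post xi G1) big_mkcond; apply: ler_sum => i _.
by case: ifP => // _; exact: post_ge0.
Qed.

Lemma post_le1 xi k : (1 <= k <= G)%N -> p xi k <= 1.
Proof.
move=> kG; have G1 : (1 <= G)%N by lia.
have := sum_post_le1 xi (pred1 k) G1.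
rewrite (eq_bigl (fun i => i == k))// big_nat1_eq.
by rewrite ifT//; lia.
Qed.

(* The exponent 1/8 of the weight ratio (hence 1/16 of the log-weights) keeps
   the exponential moments of the chi-square terms finite and, since
   E exp (xi^2 / 8) <= exp (1 / 6) and 1 / 6 < 3 / 16, below the penalty. *)
Lemma post_le_ratio xi k m : (1 <= k <= G)%N -> (1 <= m <= G)%N ->
  p xi k <= expR ((normsig eta lam tau eps (Y xi) k
    - normsig eta lam tau eps (Y xi) m - 3 * Cl * (k%:R - m%:R)) / 16).
Proof.
move=> kG mG; set x := (X in expR (X / 16)).
have G1 : (1 <= G)%N by lia.
have px : p xi k <= expR (x / 2).
  rewrite /p /post ler_pdivrMr ?sumw_gt0//.
  have -> : postw eta lam tau Cl eps (Y xi) k = expR (x / 2) * w xi m.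
    by rewrite -expRD /postw; congr expR; rewrite /x; lra.
  rewrite ler_wpM2l ?expR_ge0//.
  rewrite (bigD1_seq m) ?iota_uniq//= ?mem_index_iota; last lia.
  by rewrite lerDl sumr_ge0// => i _; exact: expR_ge0.
have [x0|x0] := leP x 0.
  by apply: le_trans px _; rewrite ler_expR; lra.
apply: le_trans (post_le1 xi kG) _.
by rewrite -[leLHS]expR0 ler_expR; lra.
Qed.

(** Here [shrink i <= 1] and [(z + x)^2 <= 2 z^2 + 2 x^2]; dividing by 16 yields the two factors
    [1 / 8]. *)
Lemma post_le_above xi k m : (1 <= m <= k)%N -> (k <= G)%N ->
  p xi k <= expR ((\sum_(m.+1 <= i < k.+1) zbias i ^+ 2) / 8
    + (\sum_(m.+1 <= i < k.+1) xi i ^+ 2 / 8) - 3 * Cl * (k%:R - m%:R) / 16).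
Proof.
move=> mk kG; apply: le_trans (@post_le_ratio xi k m _ _) _; try lia.
rewrite ler_expR normsig_sub; last lia.
set S := \sum_(_ <= i < _) shrink i * _.
suff : S <= 2 * \sum_(m.+1 <= i < k.+1) zbias i ^+ 2
      + 16 * \sum_(m.+1 <= i < k.+1) xi i ^+ 2 / 8 by lra.
rewrite !mulr_sumr -big_split/=; apply: ler_sum_nat => i /andP[mi _].
have i1 : (1 <= i)%N by lia.
apply: (@le_trans _ _ ((zbias i + xi i) ^+ 2)).
  by rewrite ler_piMl ?sqr_ge0 ?shrink_le1.
have := sqr_ge0 (zbias i - xi i); rewrite -subr_ge0 => h.
by rewrite -subr_ge0; apply: le_trans h _; rewrite le_eqVlt; apply/orP; left; apply/eqP; field.
Qed.

(** Dropping the coordinates between [k] and [m] forgoes their signal: [(z + x)^2 >= z^2 / 2 - x^2],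
    with [shrink i] between [s0] and 1. The coefficient of [x^2] is relaxed from 1 to 2, so that the
    noise enters with the same weight [1 / 8] as in [post_le_above]. *)
Lemma post_le_below xi k m (s0 : R) : (1 <= k <= m)%N -> (m <= G)%N ->
  (forall i, (1 <= i <= G)%N -> s0 <= shrink i) ->
  p xi k <= expR (- (s0 * (\sum_(k.+1 <= i < m.+1) zbias i ^+ 2) / 32)
    + (\sum_(k.+1 <= i < m.+1) xi i ^+ 2 / 8) + 3 * Cl * (m%:R - k%:R) / 16).
Proof.
move=> km mG s0le; apply: le_trans (@post_le_ratio xi k m _ _) _; try lia.
rewrite ler_expR -[_ - normsig _ _ _ _ _ m]opprB normsig_sub; last lia.
set S := \sum_(_ <= i < _) shrink i * _.
suff : s0 * (\sum_(k.+1 <= i < m.+1) zbias i ^+ 2) / 2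
      - 16 * \sum_(k.+1 <= i < m.+1) xi i ^+ 2 / 8 <= S by lra.
rewrite !mulr_sumr mulr_suml -sumrB; apply: ler_sum_nat => i /andP[ki im].
have i1 : (1 <= i)%N by lia.
have h1 : s0 <= shrink i by apply: s0le; lia.
have h2 := shrink_le1 i1; have h3 := shrink_ge0 i1.
have := sqr_ge0 (zbias i + 2 * xi i).
have := sqr_ge0 (zbias i); have := sqr_ge0 (xi i).
set z := zbias i; set x := xi i => x2 z2 zx.
have h4 : z ^+ 2 / 2 - x ^+ 2 <= (z + x) ^+ 2 by nra.
have h5 : s0 * z ^+ 2 <= shrink i * z ^+ 2 by apply: ler_wpM2r.
have h6 : shrink i * x ^+ 2 <= x ^+ 2 by apply: ler_piMl.
have h7 : shrink i * (z ^+ 2 / 2 - x ^+ 2) <= shrink i * (z + x) ^+ 2.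
  by apply: ler_wpM2l.
lra.
Qed.

Lemma bayes_sub_sqr_le xi j : (1 <= G)%N -> (1 <= j)%N ->
  (bayes eta lam tau Cl eps (Y xi) j - th j) ^+ 2 <=
  (\sum_(1 <= k < G.+1 | (j <= k)%N) p xi k)
     * (thY eta lam tau eps (Y xi) j - th j) ^+ 2
  + (\sum_(1 <= k < G.+1 | (k < j)%N) p xi k) * beta j ^+ 2.
Proof.
move=> G1 j1.
set P := \sum_(_ <= k < _ | (j <= k)%N) _; set Q := \sum_(_ <= k < _ | _) _.
have PQ : P + Q = 1.
  rewrite -(sum_post xi G1) (bigID (fun k => (j <= k)%N))/=; congr (_ + _).
  by apply: eq_bigl => k; rewrite ltnNge.
have P0 : 0 <= P by apply: sumr_ge0 => k _; exact: post_ge0.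
have Q0 : 0 <= Q by apply: sumr_ge0 => k _; exact: post_ge0.
set D := thY _ _ _ _ _ j - th j.
have -> : bayes eta lam tau Cl eps (Y xi) j - th j = P * D - Q * beta j.
  rewrite /bayes; case: ifPn => [jG|njG].
    have -> : \sum_(1 <= m < j) post eta lam tau Cl eps (Y xi) m = Q.
      by rewrite /Q (big_nat_widen _ _ G.+1)//; lia.
    have -> : \sum_(j <= m < (Geps lam eps).+1) post eta lam tau Cl eps (Y xi) m = P.
      by rewrite /P (big_nat_widenl _ 1)//.
    by rewrite /D /beta -[in RHS](mulr1 (th j)) -PQ; have := PQ; move=> /(canRL (addrK _)) ->; ring.
  (* For [j] beyond [G] the estimator is [eta j], which is the same formula with [P = 0] and
     [Q = 1]. *)
  have P00 : P = 0.
    rewrite /P big_nat_cond big_pred0// => k; apply/negbTE.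
    by move: njG; rewrite /G; lia.
  by rewrite P00 in PQ *; rewrite add0r in PQ; rewrite PQ /beta; ring.
have -> : Q = 1 - P by rewrite -PQ addrC addKr.
have P1 : 0 <= 1 - P by rewrite -PQ addrC addKr.
(* The gap in the convexity inequality for the points [D] and [- beta j] is exactly
   [P * (1 - P) * (D + beta j) ^+ 2]. *)
have := mulr_ge0 (mulr_ge0 P0 P1) (sqr_ge0 (D + beta j)).
rewrite -subr_ge0 => h; rewrite -subr_ge0; apply: le_trans h _.
by rewrite le_eqVlt; apply/orP; left; apply/eqP; ring.
Qed.

Lemma loss_le xi (b : nat -> R) : (1 <= G)%N ->
  (forall k n, \sum_(k.+1 <= j < n) beta j ^+ 2 <= b k) ->
  (loss th eta lam tau Cl eps xi <=
   (\sum_(1 <= j < G.+1) (\sum_(1 <= k < G.+1 | (j <= k)%N) p xi k)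
        * (thY eta lam tau eps (Y xi) j - th j) ^+ 2
    + \sum_(1 <= k < G.+1) p xi k * b k)%:E)%E.
Proof.
move=> G1 bP; rewrite /loss; apply: lime_le.
  by apply: is_cvg_nneseries => n _ _; rewrite lee_fin sqr_ge0.
apply: nearW => n; rewrite sumEFin lee_fin.
apply: (@le_trans _ _ (\sum_(1 <= j < n)
  ((\sum_(1 <= k < G.+1 | (j <= k)%N) p xi k)
     * (thY eta lam tau eps (Y xi) j - th j) ^+ 2
   + (\sum_(1 <= k < G.+1 | (k < j)%N) p xi k) * beta j ^+ 2))).
  by apply: ler_sum_nat => j /andP[j1 _]; exact: bayes_sub_sqr_le.
rewrite big_split/=; apply: lerD.
  pose F j := (\sum_(1 <= k < G.+1 | (j <= k)%N) p xi k)
        * (thY eta lam tau eps (Y xi) j - th j) ^+ 2.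
  have F0 j : 0 <= F j.
    by rewrite mulr_ge0 ?sqr_ge0// sumr_ge0// => k _; exact: post_ge0.
  have FG j : (G < j)%N -> F j = 0.
    move=> Gj; rewrite /F big_nat_cond big_pred0 ?mul0r// => k.
    by apply/negbTE; lia.
  rewrite -[leLHS]/(\sum_(1 <= j < n) F j) -[leRHS]/(\sum_(1 <= j < G.+1) F j).
  have F0s m1 m2 : 0 <= \sum_(m1 <= j < m2) F j.
    by apply: sumr_ge0 => j _; exact: F0.
  have [nG|Gn] := leqP n G.+1.
    have [n1|n1] := leqP n 1; first by rewrite big_geq.
    by rewrite [leRHS](@big_cat_nat _ _ _ n)//= ?lerDl//; lia.
  rewrite (@big_cat_nat _ _ _ G.+1)//=; last lia.
  rewrite [X in _ + X]big_nat_cond [X in _ + X]big1 ?addr0// => j.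
  by rewrite andbT => /andP[Gj _]; exact: FG.
(* Exchanging the sums collects, for each dimension [k], the squared biases of all [j > k], which
   [b k] bounds. *)
under eq_bigr do rewrite mulr_suml big_mkcond/=.
rewrite exchange_big_nat/=; apply: ler_sum_nat => k /andP[k1 kG].
rewrite -big_mkcond -mulr_sumr ler_wpM2l ?post_ge0//=.
apply: le_trans (bP k n).
by rewrite [leRHS](big_nat_widenl _ 1)//.
Qed.

(** The error is a noise term [shrink j * r * xi j] minus a shrinkage bias
    [(1 - shrink j) * beta j]. The lower bound on [tau j] makes both squares of order
    [eps * Lam lam j]. *)
Lemma thY_sqr_le xi j (d b0 : R) : (1 <= j)%N -> 0 < d ->
  d * (Num.sqrt eps * Num.sqrt (Lam lam j)) <= tau j -> beta j ^+ 2 <= b0 ->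
  (thY eta lam tau eps (Y xi) j - th j) ^+ 2 <=
    2 * (eps * Lam lam j) * (xi j ^+ 2 + b0 / d ^+ 2).
Proof.
move=> j1 d0 dt bb.
have L0 := Lam_gt0 j1; have t0 := tau0 j1; have l0 := lam0 j1.
set r := Num.sqrt eps / lam j.
have r2 : r ^+ 2 = eps * Lam lam j by rewrite /r exprMn sqe exprVn.
have -> : thY eta lam tau eps (Y xi) j - th j =
    shrink j * r * xi j - (1 - shrink j) * beta j.
  have := thY_subE xi j1; rewrite -/r /beta => h.
  have -> : thY eta lam tau eps (Y xi) j =
    shrink j * (th j - eta j + r * xi j) + eta j by rewrite -h subrK.
  by ring.
(* With [u = eps * Lam lam j], [1 - shrink j = u / (tau j + u)] is at most [u / tau j], and
   [tau j ^+ 2 >= d ^+ 2 * u]. *)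
have h1 : (1 - shrink j) ^+ 2 <= eps * Lam lam j / d ^+ 2.
  set u := eps * Lam lam j; have u0 : 0 < u by rewrite mulr_gt0.
  have tu : d ^+ 2 * u <= tau j ^+ 2.
    have -> : d ^+ 2 * u = (d * (Num.sqrt eps * Num.sqrt (Lam lam j))) ^+ 2.
      by rewrite !exprMn sqe sqr_sqrtr ?ltW.
    rewrite ler_pXn2r ?nnegrE //; last exact: ltW.
    by rewrite !mulr_ge0 ?sqrtr_ge0 ?(ltW d0).
  have -> : 1 - shrink j = u / (tau j + u).
    rewrite shrinkE// -/u; field.
    by rewrite gt_eqF// addr_gt0.
  rewrite expr_div_n ler_pdivrMr ?exprn_gt0 ?addr_gt0//.
  rewrite mulrAC ler_pdivlMr ?exprn_gt0//.
  have := ler_wpM2r (ltW u0) tu; have := mulr_gt0 u0 t0.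
  have := mulr_gt0 u0 u0; nra.
have s0 := shrink_ge0 j1; have s1 := shrink_le1 j1.
have h2 : (shrink j * r * xi j) ^+ 2 <= eps * Lam lam j * xi j ^+ 2.
  rewrite 2!exprMn r2 -mulrA ler_piMl ?exprn_ile1//.
  by apply: mulr_ge0; [apply: mulr_ge0; exact: ltW|exact: sqr_ge0].
have h3 : ((1 - shrink j) * beta j) ^+ 2 <= eps * Lam lam j * (b0 / d ^+ 2).
  rewrite exprMn.
  apply: le_trans (ler_wpM2r (sqr_ge0 _) h1) _.
  have -> : eps * Lam lam j * (b0 / d ^+ 2) = eps * Lam lam j / d ^+ 2 * b0.
    by rewrite mulrCA [RHS]mulrC.
  by rewrite ler_wpM2l// divr_ge0 ?exprn_ge0 ?mulr_ge0// ltW.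
have := sqr_ge0 (shrink j * r * xi j + (1 - shrink j) * beta j).
set A := shrink j * r * xi j in h2 *; set B := (1 - _) * _ in h3 *.
move=> AB; have : (A - B) ^+ 2 <= 2 * A ^+ 2 + 2 * B ^+ 2 by nra.
lra.
Qed.

End posterior_bounds.

(** * Risk bounds at a single noise level *)

Section risk_bounds.
Set Implicit Arguments.
Unset Strict Implicit.
Unset Printing Implicit Defensive.

Lemma big_nat_range_cond (V : nmodType) (F : nat -> V) m k n : (k <= n)%N ->
  \sum_(m.+1 <= i < k.+1) F i = \sum_(1 <= i < n.+1 | (m < i <= k)%N) F i.
Proof.
move=> kn; rewrite (big_nat_widen _ _ n.+1)// (big_nat_widenl _ 1)//.
by apply: eq_bigl => i; rewrite andbC.
Qed.

Lemma sum_cond_le_natr (R : numDomainType) n (P : pred nat) (v : R) : 0 <= v ->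
  \sum_(1 <= j < n.+1 | P j) v <= n%:R * v.
Proof.
move=> v0; apply: (@le_trans _ _ (\sum_(1 <= j < n.+1) v)).
  by rewrite big_mkcond; apply: ler_sum => i _; case: ifP.
by rewrite sumr_const_nat subn1 mulr_natl.
Qed.

Variables (R : realType) (th eta lam tau : nat -> R) (Cl eps d b0 : R).
Variable b : nat -> R.
Let G := Geps lam eps.
Hypothesis lam0 : forall j, (1 <= j)%N -> lam j != 0.
Hypothesis tau0 : forall j, (1 <= j)%N -> 0 < tau j.
Hypothesis eps0 : 0 < eps.
Hypothesis d0 : 0 < d.
Hypothesis tau_ge : forall j, (1 <= j <= G)%N ->
  d * Num.max (Num.sqrt eps * Num.sqrt (Lam lam j)) (eps * Lam lam j) <= tau j.
Hypothesis Lam_le : forall j, (1 <= j <= G)%N -> eps * Lam lam j <= Lam lam 1.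
Hypothesis bP : forall k n, \sum_(k.+1 <= j < n) (th j - eta j) ^+ 2 <= b k.
Hypothesis b_le : forall k, b k <= b0.
Hypothesis G1 : (1 <= G)%N.

Let B0 := b0 / d ^+ 2.
Let L1 := Lam lam 1.
Let Y xi := dataY th lam eps xi.
Let D2 xi j := (thY eta lam tau eps (Y xi) j - th j) ^+ 2.
Let p xi k := post eta lam tau Cl eps (Y xi) k.

Let p0 xi k : 0 <= p xi k. Proof. exact: post_ge0. Qed.
Let L10 : 0 <= L1. Proof. by rewrite ltW// Lam_gt0. Qed.

Let b00 : 0 <= b0.
Proof. by apply: le_trans (b_le 0); have := bP 0 0; rewrite big_geq. Qed.

Let B00 : 0 <= B0.
Proof. by rewrite divr_ge0// exprn_ge0// ltW. Qed.

Let beta_le j : (1 <= j)%N -> (th j - eta j) ^+ 2 <= b0.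
Proof.
move=> j1; apply: le_trans (b_le j.-1).
by have := bP j.-1 j.+1; rewrite prednK// big_nat1.
Qed.

Let sqrt_ge j : (1 <= j <= G)%N ->
  d * (Num.sqrt eps * Num.sqrt (Lam lam j)) <= tau j.
Proof.
move=> jG; apply: le_trans (tau_ge jG); rewrite ler_wpM2l ?(ltW d0)//.
by rewrite le_max lexx.
Qed.

Let D2_le xi j : (1 <= j <= G)%N ->
  D2 xi j <= 2 * (eps * Lam lam j) * (xi j ^+ 2 + B0).
Proof.
move=> jG; have j1 : (1 <= j)%N by case/andP: jG.
by apply: thY_sqr_le => //; [exact: sqrt_ge|exact: beta_le].
Qed.

(** This uses the second branch of the maximum, [d * (eps * Lam lam j) <= tau j]; the first branch
    controls the shrinkage bias in [D2_le]. *)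
Lemma shrink_ge j : (1 <= j <= G)%N -> d / (1 + d) <= shrink lam tau eps j.
Proof.
move=> jG; have j1 : (1 <= j)%N by case/andP: jG.
rewrite shrinkE//; have t0 := tau0 j1.
have u0 : 0 < eps * Lam lam j by rewrite mulr_gt0// Lam_gt0.
have tu : d * (eps * Lam lam j) <= tau j.
  apply: le_trans (tau_ge jG); rewrite ler_wpM2l ?(ltW d0)//.
  by rewrite le_max lexx orbT.
rewrite ler_pdivlMr ?addr_gt0// mulrAC ler_pdivrMr ?addr_gt0//.
nra.
Qed.

Let risk_le (g : (nat -> R) -> R) v : gauss_dom G g v ->
  (forall xi, \sum_(1 <= j < G.+1) (\sum_(1 <= k < G.+1 | (j <= k)%N) p xi k) * D2 xi j
    + \sum_(1 <= k < G.+1) p xi k * b k <= g xi) ->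
  (risk th eta lam tau Cl eps <= v%:E)%E.
Proof.
move=> gv Hg; apply: (gauss_dom_Egauss gv).
  by move=> xi; apply: nneseries_ge0 => n _ _; rewrite lee_fin sqr_ge0.
move=> xi; have H := @loss_le _ th eta lam tau Cl eps eps0 xi b G1 bP.
apply: le_trans H _.
by rewrite lee_fin; exact: Hg.
Qed.

Let tail_le1 xi (P : pred nat) : \sum_(1 <= k < G.+1 | P k) p xi k <= 1.
Proof. exact: sum_post_le1. Qed.

Let D2_ge0 xi j : 0 <= D2 xi j. Proof. exact: sqr_ge0. Qed.

(** Every posterior tail is bounded by 1 and every variance by [Lam lam 1]. The bound is linear in
    [G], which is good enough when the noise stays away from 0. *)
Lemma risk_le_crude :
  (risk th eta lam tau Cl eps <=
   (G%:R * (2 * L1 * (8 * expR (1 / 3) + B0)) + b0)%:E)%E.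
Proof.
have step xi j : (1 <= j <= G)%N ->
    (\sum_(1 <= k < G.+1 | (j <= k)%N) p xi k) * D2 xi j
    <= 2 * L1 * (xi j ^+ 2 + B0).
  move=> jG; apply: le_trans (_ : D2 xi j <= _).
    by rewrite ler_piMl// tail_le1.
  apply: le_trans (D2_le xi jG) _.
  rewrite ler_wpM2r ?addr_ge0 ?sqr_ge0//.
  by rewrite ler_wpM2l// Lam_le.
(* The range is repeated as a predicate because [gauss_dom_sum] hands only the predicate to the
   summands. *)
apply: (@risk_le (fun xi => \sum_(1 <= j < G.+1 | (1 <= j < G.+1)%N)
    (2 * L1 * (xi j ^+ 2 + B0)) + b0)).
  apply: gauss_domD; last exact: gauss_dom_cst.
  apply: (@gauss_dom_ler _ _ _ (\sum_(1 <= j < G.+1 | (1 <= j < G.+1)%N)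
    (2 * L1 * (8 * expR (1 / 3) + B0)))).
    apply: sum_cond_le_natr.
    by apply: mulr_ge0; [exact: mulr_ge0|rewrite addr_ge0// mulr_ge0// expR_ge0].
  apply: gauss_dom_sum => j jG; apply: gauss_domZ; first by rewrite mulr_ge0.
  by apply: gauss_domD; [exact: gauss_dom_sqr|exact: gauss_dom_cst].
move=> xi; apply: lerD.
  rewrite [leRHS]big_mkcond; apply: ler_sum_nat => j jG.
  by rewrite jG; exact: step.
apply: (@le_trans _ _ (\sum_(1 <= k < G.+1) p xi k * b0)).
  by apply: ler_sum => k _; rewrite ler_wpM2l.
by rewrite -mulr_suml ler_piMl// tail_le1.
Qed.

(* [m] is the oracle dimension and [M] a multiple of it; [V] is the bias level
   above which dimensions [k < m] are exponentially unlikely. *)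
Lemma risk_le_concentration (m M : nat) (A V W : R) :
  (1 <= m <= G)%N -> (m <= M)%N -> 0 <= Cl -> 0 <= V ->
  (forall n, \sum_(m.+1 <= i < n) zbias th eta lam eps i ^+ 2 <= A) ->
  (forall k, (M < k <= G)%N ->
     A / 8 + (k%:R - m%:R) / 6 - 3 * Cl * (k%:R - m%:R) / 16 <= - (2 * m%:R)) ->
  (forall k, (1 <= k <= G)%N -> V < b k -> (k <= m)%N /\
     m%:R + m%:R / 6 + 3 * Cl * m%:R / 16 <=
     d / (1 + d) * (\sum_(k.+1 <= i < m.+1) zbias th eta lam eps i ^+ 2) / 32) ->
  \sum_(1 <= j < G.+1 | (j <= M)%N) eps * Lam lam j <= W ->
  (risk th eta lam tau Cl eps <=
   (2 * W * (8 * expR (1 / 3) + B0)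
    + G%:R * (G%:R * (2 * L1 * (8 + B0) * (expR (1 / 3) * expR (- (2 * m%:R)))))
    + (V + G%:R * (b0 * (expR (1 / 3) * expR (- m%:R)))))%:E)%E.
Proof.
move=> mG mM Cl0 V0 HA HM HV HW.
have [m1 mG'] : (1 <= m)%N /\ (m <= G)%N by apply/andP.
(* [E1 k xi j] dominates the posterior weight of [k] times the squared error at [j > M]; the term
   [xi j ^+ 2 / 8] absorbs the factor [xi j ^+ 2 + B0] of that error. *)
pose E1 k (xi : nat -> R) j := expR (A / 8 - 3 * Cl * (k%:R - m%:R) / 16) *
  (2 * L1 * (8 + B0) *
   expR (\sum_(1 <= i < G.+1 | (m < i <= k)%N) xi i ^+ 2 / 8 + xi j ^+ 2 / 8)).
(* [E2 k xi] dominates the bias contribution of a dimension with [V < b k]. The nonnegative term in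
   [xi 1] only gives it the shape of [gauss_dom_expR], and the [m%:R / 6] pays for the chi-square
   sum over at most [m] coordinates. *)
pose E2 k (xi : nat -> R) := expR (- (m%:R + m%:R / 6)) *
  (b0 * expR (\sum_(1 <= i < G.+1 | (k < i <= m)%N) xi i ^+ 2 / 8 + xi 1 ^+ 2 / 8)).
pose I1 j := (1 <= j < G.+1)%N && (j <= M)%N.
pose I2 j := (1 <= j < G.+1)%N && ~~ (j <= M)%N.
pose I3 j k := (1 <= k < G.+1)%N && (j <= k)%N.
pose I4 k := (1 <= k < G.+1)%N && (V < b k).
have K0 : 0 <= 2 * L1 * (8 + B0).
  by apply: mulr_ge0; [exact: mulr_ge0|exact: addr_ge0].
have X0 : 0 <= 8 * expR (1 / 3) + B0.
  by apply: addr_ge0 => //; rewrite mulr_ge0// expR_ge0.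
apply: (@risk_le (fun xi =>
  (\sum_(1 <= j < G.+1 | I1 j) (2 * (eps * Lam lam j) * (xi j ^+ 2 + B0))
   + \sum_(1 <= j < G.+1 | I2 j) \sum_(1 <= k < G.+1 | I3 j k) E1 k xi j)
  + (V + \sum_(1 <= k < G.+1 | I4 k) E2 k xi))).
  apply: gauss_domD; first apply: gauss_domD.
  - apply: (@gauss_dom_ler _ _ _ (\sum_(1 <= j < G.+1 | I1 j)
      (2 * (eps * Lam lam j) * (8 * expR (1 / 3) + B0)))).
      rewrite -mulr_suml ler_wpM2r//.
      rewrite -mulr_sumr ler_wpM2l//; apply: le_trans HW.
      by rewrite [leRHS]big_nat_cond.
    apply: gauss_dom_sum => j /andP[jG _]; apply: gauss_domZ.
      by rewrite !mulr_ge0 ?ltW ?Lam_gt0//; case/andP: jG.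
    by apply: gauss_domD; [exact: gauss_dom_sqr|exact: gauss_dom_cst].
  - set v := 2 * L1 * (8 + B0) * (expR (1 / 3) * expR (- (2 * m%:R))).
    have v0 : 0 <= v by rewrite mulr_ge0// mulr_ge0 ?expR_ge0.
    apply: (@gauss_dom_ler _ _ _ (\sum_(1 <= j < G.+1 | I2 j)
       \sum_(1 <= k < G.+1 | I3 j k) v)).
      have Gv0 : 0 <= G%:R * v by rewrite mulr_ge0.
      apply: le_trans (sum_cond_le_natr G I2 Gv0).
      by apply: ler_sum => j _; exact: sum_cond_le_natr.
    apply: gauss_dom_sum => j /andP[jG jM].
    apply: gauss_dom_sum => k /andP[kG jk].
    apply: gauss_dom_ler (gauss_domZ (expR_ge0 _) (gauss_domZ K0
      (gauss_dom_expR (fun i => (m < i <= k)%N) jG))).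
    rewrite /v mulrCA ler_wpM2l// -!expRD ler_expR.
    have kG' : (k <= G)%N by case/andP: kG.
    have Mk : (M < k)%N by apply: leq_trans jk; rewrite ltnNge.
    have mk : (m <= k)%N by apply: leq_trans mM (ltnW Mk).
    rewrite -(big_nat_range_cond (fun=> 1 / 6) _ kG').
    rewrite sumr_const_nat subSS -[1 / 6 *+ _]mulr_natl natrB//.
    have := HM k; rewrite Mk kG' => /(_ isT).
    lra.
  apply: gauss_domD; first exact: gauss_dom_cst.
  set v := b0 * _; have v0 : 0 <= v by rewrite mulr_ge0// mulr_ge0 ?expR_ge0.
  apply: (@gauss_dom_ler _ _ _ (\sum_(1 <= k < G.+1 | I4 k) v)).
    exact: sum_cond_le_natr.
  apply: gauss_dom_sum => k /andP[kG Vk].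
  have h1 : (1 <= 1 < G.+1)%N by rewrite ltnS.
  apply: gauss_dom_ler (gauss_domZ (expR_ge0 _) (gauss_domZ b00
      (gauss_dom_expR (fun i => (k < i <= m)%N) h1))).
  rewrite /v mulrCA ler_wpM2l// -!expRD ler_expR.
  have [km _] := HV _ kG Vk.
  rewrite -(big_nat_range_cond (fun=> 1 / 6) _ mG').
  rewrite sumr_const_nat subSS -[1 / 6 *+ _]mulr_natl natrB//.
  have : 0 <= k%:R :> R by [].
  lra.
move=> xi; apply: lerD.
  rewrite (bigID (fun j => (j <= M)%N))/= big_nat_cond.
  rewrite [X in _ + X <= _]big_nat_cond.
  apply: lerD; apply: ler_sum => j.
    move=> /andP[jG jM].
    apply: (le_trans _ (D2_le xi jG)).
    by rewrite ler_piMl// tail_le1.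
  move=> /andP[jG jM]; rewrite mulr_suml [leLHS]big_nat_cond.
  apply: ler_sum => k /andP[kG jk].
  have kG' : (k <= G)%N by case/andP: kG.
  have mk : (1 <= m <= k)%N.
    rewrite m1 /=; apply: leq_trans mM _; apply: leq_trans jk.
    by rewrite ltnW// ltnNge.
  have := post_le_above th eta Cl lam0 tau0 eps0 xi mk kG'.
  rewrite -/(p xi k) => pk.
  (* From [y <= expR y] at [y = xi j ^+ 2 / 8], and [1 <= expR y] for the constant [B0]. *)
  have Dk : D2 xi j <= 2 * L1 * (8 + B0) * expR (xi j ^+ 2 / 8).
    apply: le_trans (D2_le xi jG) _.
    apply: (@le_trans _ _ (2 * L1 * (xi j ^+ 2 + B0))).
      rewrite ler_wpM2r ?addr_ge0 ?sqr_ge0//.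
      by rewrite ler_wpM2l// Lam_le.
    rewrite -[leRHS]mulrA ler_wpM2l ?mulr_ge0// mulrDl; apply: lerD.
      by have := expR_ge1Dx (xi j ^+ 2 / 8); lra.
    by rewrite ler_peMr// -expR0 ler_expR divr_ge0// sqr_ge0.
  apply: le_trans (ler_pM (p0 _ _) (D2_ge0 _ _) pk Dk) _.
  rewrite /E1 [leRHS]mulrCA [leLHS]mulrCA ler_wpM2l// -!expRD ler_expR.
  rewrite (big_nat_range_cond (fun i => xi i ^+ 2 / 8) m kG').
  have := HA k.+1; lra.
(* A bias is at most [V], or else at most [b0] on the dimensions exceeding that level. *)
apply: (@le_trans _ _ (\sum_(1 <= k < G.+1) p xi k * V
   + \sum_(1 <= k < G.+1 | I4 k) p xi k * b0)).
  rewrite [X in _ <= _ + X]big_mkcond -big_split/=.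
  apply: ler_sum_nat => k kG; rewrite /I4 kG /=.
  case: ifPn => Vk.
    by rewrite -mulrDr ler_wpM2l// ler_wpDl.
  by rewrite addr0 ler_wpM2l// leNgt.
apply: lerD; first by rewrite -mulr_suml ler_piMl// tail_le1.
apply: ler_sum => k /andP[kG Vk]; have [km Hk] := HV _ kG Vk.
rewrite /E2 mulrCA mulrC ler_wpM2l//.
have km' : (1 <= k <= m)%N by rewrite km andbT; case/andP: kG.
apply: le_trans (post_le_below th eta Cl lam0 tau0 eps0 xi km' mG' shrink_ge) _.
rewrite -expRD ler_expR (big_nat_range_cond (fun i => xi i ^+ 2 / 8) k mG').
have h1 : 0 <= xi 1 ^+ 2 by exact: sqr_ge0.
have h2 : 0 <= Cl * k%:R by rewrite mulr_ge0.
lra.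
Qed.

End risk_bounds.

(** * Bias, variance and oracle, and the assumptions in usable form *)

Section bias_variance.
Set Implicit Arguments.
Unset Strict Implicit.
Unset Printing Implicit Defensive.
Variables (R : realType) (th eta lam : nat -> R) (Cl Ll : R).
Hypothesis lam0 : forall j, (1 <= j)%N -> lam j != 0.
Hypothesis cvgb : cvgn (fun n => \sum_(1 <= j < n) (th j - eta j) ^+ 2).
Hypothesis hE : AssumptionE lam Cl Ll.
Implicit Types (j k m n : nat).

Let sq j := (th j - eta j) ^+ 2.
Let sum_sq_nd m : nondecreasing_seq (fun n => \sum_(m.+1 <= j < n) sq j).
Proof.
move=> n1 n2 n12 /=; have [mn|nm] := leqP m.+1 n1; last first.
  by rewrite big_geq ?(ltnW nm)// sumr_ge0// => j _; exact: sqr_ge0.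
rewrite [leRHS](@big_cat_nat _ _ _ n1)//= lerDl sumr_ge0// => j _.
exact: sqr_ge0.
Qed.

Lemma bias_is_cvg m : cvgn (fun n => \sum_(m.+1 <= j < n) sq j).
Proof.
apply: nondecreasing_is_cvgn; first exact: sum_sq_nd.
exists (limn (fun n => \sum_(1 <= j < n) sq j)) => _ [n _ <-].
apply: le_trans (nondecreasing_cvgn_le (@sum_sq_nd 0) cvgb n).
have [mn|nm] := leqP m.+1 n; last first.
  by rewrite big_geq ?(ltnW nm)// sumr_ge0// => j _; exact: sqr_ge0.
rewrite [leRHS](@big_cat_nat _ _ _ m.+1)//= lerDr sumr_ge0// => j _.
exact: sqr_ge0.
Qed.

Lemma sum_sqr_le_bias m n :
  \sum_(m.+1 <= j < n) (th j - eta j) ^+ 2 <= bias th eta m.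
Proof.
exact: (nondecreasing_cvgn_le (@sum_sq_nd m) (@bias_is_cvg m) n).
Qed.

Lemma bias_ge0 m : 0 <= bias th eta m.
Proof. by have := sum_sqr_le_bias m 0; rewrite big_geq. Qed.

Lemma bias_le_sumD k m : (k <= m)%N ->
  bias th eta k <=
    \sum_(k.+1 <= j < m.+1) (th j - eta j) ^+ 2 + bias th eta m.
Proof.
move=> km; apply: limr_le; first exact: bias_is_cvg.
apply: nearW => n; have [mn|nm] := leqP m.+1 n; last first.
  apply: le_trans (_ : \sum_(k.+1 <= j < m.+1) sq j <= _).
    by apply: sum_sq_nd; exact: ltnW.
  by rewrite lerDl bias_ge0.
by rewrite (@big_cat_nat _ _ _ m.+1)//= lerD2l sum_sqr_le_bias.
Qed.

Lemma bias_nincr k m : (k <= m)%N -> bias th eta m <= bias th eta k.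
Proof.
move=> km; apply: limr_le; first exact: bias_is_cvg.
apply: nearW => n; apply: le_trans (sum_sqr_le_bias k n).
have [mn|nm] := leqP m.+1 n; last first.
  by rewrite big_geq ?(ltnW nm)// sumr_ge0// => j _; exact: sqr_ge0.
rewrite [leRHS](@big_cat_nat _ _ _ m.+1)//= lerDr sumr_ge0// => j _.
exact: sqr_ge0.
Qed.

Lemma mulr_Lbar (eps : R) m : (1 <= m)%N ->
  eps * m%:R * Lbar lam m = \sum_(1 <= j < m.+1) eps * Lam lam j.
Proof.
move=> m1; rewrite /Lbar -mulr_sumr mulrA -(mulrA eps) divff ?mulr1//.
by rewrite pnatr_eq0 -lt0n.
Qed.

Lemma Lam_le_Lmax j m : (1 <= j <= m)%N -> Lam lam j <= Lmax lam m.
Proof.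
move=> jm; rewrite /Lmax; apply: (@le_bigmax_seq _ _ _ _ _ j xpredT (Lam lam)) => //.
by rewrite mem_index_iota.
Qed.

Lemma Lmax_gt0 m : (1 <= m)%N -> 0 < Lmax lam m.
Proof. by move=> m1; apply: lt_le_trans (Lam_gt0 lam0 m1) (Lam_le_Lmax _); rewrite m1 leqnn. Qed.

Lemma Lbar_gt0 m : (1 <= m)%N -> 0 < Lbar lam m.
Proof.
move=> m1; rewrite mulr_gt0 ?invr_gt0 ?ltr0n//.
rewrite big_ltn// ltr_wpDr ?Lam_gt0// big_nat_cond sumr_ge0// => j.
by rewrite andbT => /andP[j2 _]; rewrite ltW// Lam_gt0//; exact: ltnW.
Qed.

Lemma Cl_ge1 : 1 <= Cl. Proof. by case: hE. Qed.

Lemma Lmax_le_Lam m i : (1 <= m < i)%N -> Lmax lam m <= Cl * Lam lam i.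
Proof.
move=> /andP[m1 mi]; have C1 := Cl_ge1.
have Li : 0 < Lam lam i by apply: Lam_gt0 => //; exact: leq_trans mi.
rewrite /Lmax big_nat_cond; apply: bigmax_le.
  by rewrite mulr_ge0 ?(le_trans ler01 C1)// ltW.
move=> j; rewrite andbT => /andP[j1 jm].
case: hE => _ _ /(_ m 1 m1 isT)[/(_ i j mi) h _ _].
have {h} : lam i ^+ 2 <= Cl * lam j ^+ 2 by apply: h; rewrite j1.
have li : 0 < lam i ^+ 2 by rewrite -invr_gt0.
have lj : 0 < lam j ^+ 2 by rewrite exprn_even_gt0//= lam0.
by rewrite /Lam ler_pdivlMr// ler_pdivrMl// [leRHS]mulrC.
Qed.

Lemma Lmax_ge0 m : 0 <= Lmax lam m.
Proof. by rewrite /Lmax; apply: bigmax_ge_id. Qed.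

(** Assumption E gives [Lam lam j >= Lam lam 1 / Cl] for all [j]. The resulting linear growth lets
    the minimum over all dimensions be attained. *)
Lemma Phi_ge_linear (eps : R) m : 0 < eps -> (1 <= m)%N ->
  eps * m%:R * (Lam lam 1 / Cl) <= Phi th eta lam eps m.
Proof.
move=> e0 m1; apply: (@le_trans _ _ (eps * m%:R * Lbar lam m)); last first.
  by rewrite le_max lexx orbT.
have C1 := Cl_ge1; have C0 : 0 < Cl by apply: lt_le_trans C1.
rewrite mulr_Lbar// -mulrA -mulr_sumr ler_wpM2l ?(ltW e0)//.
apply: (@le_trans _ _ (\sum_(1 <= j < m.+1) Lam lam 1 / Cl)).
  by rewrite sumr_const_nat subn1 /= mulr_natl.
apply: ler_sum_nat => j /andP[j1 _]; rewrite ler_pdivrMr// mulrC.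
have [->|j2] := eqVneq j 1%N; first by rewrite ler_peMl// ltW// Lam_gt0.
apply: le_trans (_ : Lmax lam 1 <= _); first exact: Lam_le_Lmax.
by apply: Lmax_le_Lam; lia.
Qed.

(** Existence of a minimizer ensures that [mo] is not the default value of [xget]. *)
Lemma mo_spec (eps : R) : 0 < eps -> is_mo th eta lam eps (mo th eta lam eps).
Proof.
move=> e0; apply: xgetPex.
set F := Phi th eta lam eps.
have C1 := Cl_ge1; have C0 : 0 < Cl by apply: lt_le_trans C1.
have r0 : 0 < eps * (Lam lam 1 / Cl) by rewrite mulr_gt0// divr_gt0// Lam_gt0.
(* From [N] on, the linear lower bound exceeds the value at dimension 1, so minimizing over indices
   up to [N] suffices. *)
pose N := (Num.truncn (F 1%N / (eps * (Lam lam 1 / Cl)))).+1.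
have FN k : (N <= k)%N -> F 1%N <= F k.
  move=> Nk; have k1 : (1 <= k)%N by exact: leq_trans Nk.
  apply: le_trans (Phi_ge_linear e0 k1).
  rewrite mulrAC -ler_pdivrMl// mulrC ltW//.
  by apply: lt_le_trans (truncnS_gt _) _; rewrite ler_nat.
have [i /= i1 imin] : exists2 i : 'I_N.+1, (1 <= i)%N &
    forall j : 'I_N.+1, (1 <= j)%N -> F i <= F j.
  have h1 : (1 < N.+1)%N by [].
  have [i i1 imin] := @arg_minP _ _ _ (Ordinal h1)
    (fun i : 'I_N.+1 => (1 <= i)%N) (fun i : 'I_N.+1 => F i) isT.
  by exists i.
have imin' k : (1 <= k)%N -> F i <= F k.
  move=> k1; have [kN|Nk] := ltnP k N.+1; first exact: (imin (Ordinal kN)).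
  have h1 : (1 < N.+1)%N by [].
  apply: le_trans (imin (Ordinal h1) isT) _; exact: FN (ltnW Nk).
pose P m := (1 <= m)%N && `[< forall k, (1 <= k)%N -> F m <= F k >].
have exP : exists m, P m by exists i; rewrite /P i1; apply/asboolP.
exists (ex_minn exP); case: ex_minnP => m /andP[m1 /asboolP mmin] mleast.
split => // m' m'1 m'min; apply: mleast; rewrite /P m'1.
exact/asboolP.
Qed.

Lemma Phio_mo (eps : R) : 0 < eps ->
  Phio th eta lam eps = Phi th eta lam eps (mo th eta lam eps).
Proof.
move=> e0; have [m1 mmin _] := mo_spec e0.
apply/eqP; rewrite eq_le; apply/andP; split.
  apply: ge_inf; last by exists (mo th eta lam eps).
  by exists (Phi th eta lam eps (mo th eta lam eps)) => _ [k /= k1 <-]; exact: mmin.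
apply: lb_le_inf; first by exists (Phi th eta lam eps 1); exists 1%N.
by move=> _ [k /= k1 <-]; exact: mmin.
Qed.

Lemma Phio_ge (eps : R) : 0 < eps -> eps * Lam lam 1 <= Phio th eta lam eps.
Proof.
move=> e0; rewrite Phio_mo//; have [m1 _ _] := mo_spec e0.
apply: (@le_trans _ _ (eps * (mo th eta lam eps)%:R * Lbar lam (mo th eta lam eps))).
  rewrite mulr_Lbar// big_ltn// lerDl big_nat_cond sumr_ge0// => j.
  rewrite andbT => /andP[j2 _]; rewrite mulr_ge0 ?(ltW e0)// ltW// Lam_gt0//.
  exact: ltnW.
by rewrite le_max lexx orbT.
Qed.

Lemma Phio_gt0 (eps : R) : 0 < eps -> 0 < Phio th eta lam eps.
Proof.
by move=> e0; apply: lt_le_trans (Phio_ge e0); rewrite mulr_gt0// Lam_gt0.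
Qed.

Lemma Phio_le (eps : R) : 0 < eps <= 1 ->
  Phio th eta lam eps <= bias th eta 0 + Lam lam 1.
Proof.
move=> /andP[e0 e1]; rewrite Phio_mo//; have [_ mmin _] := mo_spec e0.
apply: le_trans (mmin 1%N isT) _.
have L1 := Lam_gt0 lam0 (leqnn 1).
rewrite ge_max; apply/andP; split.
  by apply: le_trans (bias_nincr (leq0n 1)) _; rewrite lerDl ltW.
rewrite mulr_Lbar// big_nat1; apply: (@le_trans _ _ (Lam lam 1)).
  by rewrite ler_piMl// ltW.
by rewrite lerDr bias_ge0.
Qed.

(** The guard [1 <= n] makes [K] hold at 0, the value of an empty maximum, and [maxn] returns one of
    its arguments; hence the maximum inherits [K] from the admissible dimensions. *)
Lemma Geps_spec (eps : R) : 0 < eps -> (1 <= Geps lam eps)%N ->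
  eps * Lmax lam (Geps lam eps) <= Lam lam 1 /\ (Geps lam eps)%:R <= eps^-1.
Proof.
move=> e0; pose K n := (1 <= n)%N ->
  eps * Lmax lam n <= Lam lam 1 /\ n%:R <= eps^-1.
suff : K (Geps lam eps) by [].
rewrite /Geps big_nat_cond; apply: (big_ind K) => //.
- by move=> x y Kx Ky; rewrite /maxn; case: ifP.
- move=> m /andP[/andP[m1 mt] eL] _; split => //.
  apply: le_trans (_ : (Num.truncn eps^-1)%:R <= _); first by rewrite ler_nat.
  by rewrite truncn_le invr_ge0 ltW.
Qed.

(** [kappa] is the infimum itself. The ratios are bounded below by 0, which makes [inf] a genuine
    lower bound. *)
Lemma AssumptionO_le (eps_o : R) : AssumptionO th eta lam eps_o ->
  exists2 kappa : R, 0 < kappa & forall eps, 0 < eps < eps_o ->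
    kappa * Phio th eta lam eps <=
    eps * (mo th eta lam eps)%:R * Lbar lam (mo th eta lam eps).
Proof.
rewrite /AssumptionO; set S := [set _ | _ in _]%classic => S0.
exists (inf S) => // eps /andP[e0 eo]; have P0 := Phio_gt0 e0.
apply: (@le_trans _ _ ((Phio th eta lam eps)^-1 *
    Num.min (bias th eta (mo th eta lam eps))
      (eps * (mo th eta lam eps)%:R * Lbar lam (mo th eta lam eps))
    * Phio th eta lam eps)); last first.
  by rewrite mulrAC mulVf ?gt_eqF// mul1r ge_min lexx orbT.
rewrite ler_wpM2r ?(ltW P0)//; apply: ge_inf; last first.
  by exists eps => //=; rewrite in_itv/= e0.
exists 0 => x [e /=]; rewrite in_itv/= => /andP[e0' _] <-.
have [m1 _ _] := mo_spec e0'.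
rewrite mulr_ge0 ?invr_ge0 ?(ltW (Phio_gt0 e0'))// le_min bias_ge0/=.
by rewrite mulr_ge0 ?(ltW (Lbar_gt0 m1))// mulr_ge0// ltW.
Qed.

(** Tolerance 1 in the limit gives [ln (G / Phio) < m] for small noise; exponentiating gives the
    claim. *)
Lemma Geps_exp_le :
  (fun e => ln ((Geps lam e)%:R / Phio th eta lam e) / (mo th eta lam e)%:R)
      @ 0^'+ --> 0 ->
  exists2 e1 : R, 0 < e1 & forall eps, 0 < eps < e1 -> (1 <= Geps lam eps)%N ->
    (Geps lam eps)%:R * expR (- (mo th eta lam eps)%:R) <= Phio th eta lam eps.
Proof.
move=> /cvgr0_norm_lt /(_ 1 ltr01) /=.
rewrite near_withinE => /nbhs_ballP[e1 /= e10 H].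
exists e1 => // eps /andP[e0 ee1] G1.
have := H eps; rewrite /ball/= sub0r normrN gtr0_norm// => /(_ ee1 e0).
have [m1 _ _] := mo_spec e0; have P0 := Phio_gt0 e0.
have mR : 0 < (mo th eta lam eps)%:R :> R by rewrite ltr0n.
have GP : 0 < (Geps lam eps)%:R / Phio th eta lam eps.
  by rewrite divr_gt0// ltr0n.
move=> /(le_lt_trans (ler_norm _)); rewrite ltr_pdivrMr// mul1r => h.
rewrite expRN ler_pdivrMr ?expR_gt0// mulrC -ler_pdivrMr//.
by rewrite -[leLHS]lnK ?posrE// ler_expR ltW.
Qed.

End bias_variance.

(** * Signal and variance compared with the oracle rate *)

Section oracle_rate.
Set Implicit Arguments.
Unset Strict Implicit.
Unset Printing Implicit Defensive.
Variables (R : realType) (th eta lam : nat -> R) (Cl Ll : R).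
Hypothesis lam0 : forall j, (1 <= j)%N -> lam j != 0.
Hypothesis cvgb : cvgn (fun n => \sum_(1 <= j < n) (th j - eta j) ^+ 2).
Hypothesis hE : AssumptionE lam Cl Ll.
Implicit Types (j k m n : nat).

Let b := bias th eta.
Let C1 : 1 <= Cl. Proof. exact: Cl_ge1 hE. Qed.
Let C0 : 0 < Cl. Proof. exact: lt_le_trans C1. Qed.
Let L0 : 0 < Ll. Proof. by apply: lt_le_trans ltr01 _; case: hE. Qed.

Lemma zbias_sqr (eps : R) i : 0 < eps -> (1 <= i)%N ->
  zbias th eta lam eps i ^+ 2 = (th i - eta i) ^+ 2 / (eps * Lam lam i).
Proof.
move=> e0 i1; rewrite /zbias /Lam exprMn exprVn sqr_sqrtr ?(ltW e0)// exprMn.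
by field; rewrite lam0// gt_eqF.
Qed.

Lemma Lbar_le_Lmax m : (1 <= m)%N -> Lbar lam m <= Lmax lam m.
Proof.
move=> m1; rewrite /Lbar ler_pdivrMl ?ltr0n//.
apply: (@le_trans _ _ (\sum_(1 <= j < m.+1) Lmax lam m)).
  by apply: ler_sum_nat => j jm; exact: Lam_le_Lmax.
by rewrite sumr_const_nat subn1 mulr_natl.
Qed.

(** Beyond [m] each [Lam lam i] is at least [Lmax lam m / Cl], so the sum is at most
    [Cl * b m / (eps * Lmax lam m)]; then [kappa * b m <= eps * m * Lmax lam m]. *)
Lemma sum_zbias_above (eps kappa Phi0 : R) m n : 0 < eps -> 0 < kappa ->
  (1 <= m)%N -> b m <= Phi0 -> kappa * Phi0 <= eps * m%:R * Lbar lam m ->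
  \sum_(m.+1 <= i < n) zbias th eta lam eps i ^+ 2 <= Cl * m%:R / kappa.
Proof.
move=> e0 k0 m1 bP kP; have Lm := Lmax_gt0 lam0 m1.
apply: (@le_trans _ _ (Cl / (eps * Lmax lam m) * b m)).
  apply: le_trans (_ : \sum_(m.+1 <= i < n)
      Cl / (eps * Lmax lam m) * (th i - eta i) ^+ 2 <= _); last first.
    rewrite -mulr_sumr ler_wpM2l ?sum_sqr_le_bias//.
    by rewrite divr_ge0 ?mulr_ge0// ltW.
  apply: ler_sum_nat => i /andP[mi _].
  have i1 : (1 <= i)%N by exact: leq_trans mi.
  have Li := Lam_gt0 lam0 i1.
  rewrite zbias_sqr// [leRHS]mulrC ler_wpM2l ?sqr_ge0//.
  rewrite ler_pdivlMr ?mulr_gt0// ler_pdivrMl ?mulr_gt0//.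
  rewrite -mulrA ler_wpM2l ?(ltW e0)// mulrC.
  by apply: (Lmax_le_Lam lam0 hE); rewrite m1.
rewrite mulrAC ler_pdivrMr ?mulr_gt0//.
rewrite -!mulrA ler_wpM2l ?(ltW C0)//.
rewrite mulrCA ler_pdivlMl//.
apply: le_trans (_ : kappa * Phi0 <= _); first by rewrite ler_wpM2l ?(ltW k0).
apply: le_trans kP _; rewrite [leRHS]mulrCA -[leLHS]mulrA.
by rewrite ler_wpM2l ?(ltW e0)// ler_wpM2l// Lbar_le_Lmax.
Qed.

(** Up to [m] each [Lam lam i] is at most [Lmax lam m], so the sum is at least
    [(b k - b m) / (eps * Lmax lam m)]. The numerator is at least [(D - 1) * Phi0], and
    [eps * m * Lmax lam m <= Ll * Phi0]. *)
Lemma sum_zbias_below (eps D Phi0 : R) k m : 0 < eps -> 0 < Phi0 -> 1 <= D ->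
  (1 <= k <= m)%N -> b m <= Phi0 -> eps * m%:R * Lbar lam m <= Phi0 ->
  D * Phi0 <= b k ->
  (D - 1) * m%:R / Ll <= \sum_(k.+1 <= i < m.+1) zbias th eta lam eps i ^+ 2.
Proof.
move=> e0 P0 D1 /andP[k1 km] bP vP bk.
have m1 : (1 <= m)%N by exact: leq_trans km.
have Lm := Lmax_gt0 lam0 m1.
apply: (@le_trans _ _ ((b k - b m) / (eps * Lmax lam m))); last first.
  apply: (@le_trans _ _ (\sum_(k.+1 <= i < m.+1)
      (th i - eta i) ^+ 2 / (eps * Lmax lam m))).
    rewrite -mulr_suml ler_wpM2r ?invr_ge0 ?mulr_ge0 ?(ltW e0) ?(ltW Lm)//.
    by rewrite lerBlDr; exact: bias_le_sumD.
  apply: ler_sum_nat => i /andP[ki im].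
  have i1 : (1 <= i)%N by exact: leq_trans ki.
  rewrite zbias_sqr// ler_wpM2l ?sqr_ge0// lef_pV2 ?posrE ?mulr_gt0 ?(Lam_gt0 lam0)//.
  by rewrite ler_wpM2l ?(ltW e0)// Lam_le_Lmax// i1.
have h1 : (D - 1) * Phi0 <= b k - b m by rewrite mulrBl mul1r lerB.
apply: (@le_trans _ _ ((D - 1) * Phi0 / (eps * Lmax lam m))); last first.
  by rewrite ler_wpM2r ?invr_ge0 ?mulr_ge0 ?(ltW e0) ?(ltW Lm).
rewrite -!mulrA ler_wpM2l ?subr_ge0//.
have h2 : Lmax lam m <= Ll * Lbar lam m.
  by rewrite -ler_pdivrMr ?(Lbar_gt0 lam0)//; case: hE => _ _ /(_ m m m1 m1)[].
rewrite ler_pdivrMr// mulrAC ler_pdivlMr ?mulr_gt0//.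
apply: le_trans (_ : eps * m%:R * Lbar lam m * Ll <= _); last first.
  by rewrite ler_wpM2r ?(ltW L0).
have m0 : 0 <= m%:R :> R by [].
have em0 : 0 <= eps * m%:R by rewrite mulr_ge0 ?(ltW e0).
by have := ler_wpM2l em0 h2; lra.
Qed.

(** At most [c * m] terms, each bounded by submultiplicativity of [Lmax] and by
    [Lmax lam m <= Ll * Lbar lam m]. *)
Lemma variance_range_le (eps : R) c m n : 0 < eps -> (1 <= c)%N -> (1 <= m)%N ->
  \sum_(1 <= j < n.+1 | (j <= c * m)%N) eps * Lam lam j
  <= c%:R * Lmax lam c * Ll * (eps * m%:R * Lbar lam m).
Proof.
move=> e0 c1 m1.
have h2 : Lmax lam m <= Ll * Lbar lam m.
  by rewrite -ler_pdivrMr ?(Lbar_gt0 lam0)//; case: hE => _ _ /(_ m m m1 m1)[].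
have h3 : Lmax lam (c * m) <= Lmax lam c * Lmax lam m.
  by case: hE => _ _ /(_ c m c1 m1)[].
apply: (@le_trans _ _ (\sum_(1 <= j < (c * m).+1) eps * Lmax lam (c * m))).
  (* Neither of [n] and [c * m] need be the larger; both sums are extended to a common range and
     compared termwise. *)
  rewrite (big_nat_widen _ _ (maxn n (c * m)).+1) ?ltnS ?leq_maxl//.
  rewrite [leRHS](big_nat_widen _ _ (maxn n (c * m)).+1) ?ltnS ?leq_maxr//.
  rewrite big_nat_cond [leRHS]big_nat_cond big_mkcond [leRHS]big_mkcond.
  apply: ler_sum => j _ /=; rewrite ltnS; case: (1 <= j)%N / idP => [j1|]//=.
  have h5 : 0 <= eps * Lmax lam (c * m) by rewrite mulr_ge0 ?(ltW e0) ?Lmax_ge0.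
  case: ifP => [/andP[_ /andP[jc _]]|_]; last by case: ifP.
  case: ifPn => [_|]; first by rewrite ler_wpM2l ?(ltW e0)// Lam_le_Lmax// j1.
  by rewrite ltnS jc andbT leq_max jc orbT.
rewrite sumr_const_nat subn1 /= -[leLHS]mulr_natl natrM.
apply: (@le_trans _ _ (c%:R * m%:R * (eps * (Lmax lam c * (Ll * Lbar lam m))))).
  rewrite ler_wpM2l// ler_wpM2l ?(ltW e0)//; apply: le_trans h3 _.
  by rewrite ler_wpM2l ?Lmax_ge0.
by rewrite le_eqVlt; apply/orP; left; apply/eqP; ring.
Qed.

End oracle_rate.

(** * Constants uniform in the noise level and the prior variances *)

Section oracle_bound.
Set Implicit Arguments.
Unset Strict Implicit.
Unset Printing Implicit Defensive.
Variables (R : realType) (th eta lam : nat -> R) (Cl Ll d : R).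
Hypothesis lam0 : forall j, (1 <= j)%N -> lam j != 0.
Hypothesis cvgb : cvgn (fun n => \sum_(1 <= j < n) (th j - eta j) ^+ 2).
Hypothesis hE : AssumptionE lam Cl Ll.
Hypothesis d0 : 0 < d.
Implicit Types (tau : nat -> R) (eps : R).

Let b0 := bias th eta 0.
Let L1 := Lam lam 1.
Let B0 := b0 / d ^+ 2.
Let G := Geps lam.
Let mo := mo th eta lam.
Let Phio := Phio th eta lam.

Let C1 : 1 <= Cl. Proof. exact: Cl_ge1 hE. Qed.
Let C0 : 0 < Cl. Proof. exact: lt_le_trans C1. Qed.
Let Ll0 : 0 < Ll. Proof. by apply: lt_le_trans ltr01 _; case: hE. Qed.
Let b00 : 0 <= b0. Proof. exact: bias_ge0. Qed.
Let B00 : 0 <= B0. Proof. by rewrite divr_ge0// exprn_ge0// ltW. Qed.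
Let L10 : 0 < L1. Proof. exact: Lam_gt0. Qed.

Let tau_cond eps tau := (forall j, (1 <= j)%N -> 0 < tau j) /\
  (forall j, (1 <= j <= G eps)%N ->
    d * Num.max (Num.sqrt eps * Num.sqrt (Lam lam j)) (eps * Lam lam j) <= tau j).

Let Lam_le eps : 0 < eps -> (1 <= G eps)%N ->
  forall j, (1 <= j <= G eps)%N -> eps * Lam lam j <= L1.
Proof.
move=> e0 G1 j jG; have [h _] := Geps_spec e0 G1.
by apply: le_trans h; rewrite ler_wpM2l ?(ltW e0)// Lam_le_Lmax.
Qed.

(** For [eps >= e1] the crude bound is at most a constant, as [G eps <= eps^-1 <= e1^-1], while
    [Phio eps >= e1 * L1]. *)
Lemma risk_le_noise_away (e1 : R) : 0 < e1 ->
  exists2 K : R, 0 <= K & forall tau eps, e1 <= eps -> (1 <= G eps)%N ->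
    tau_cond eps tau ->
    (risk th eta lam tau Cl eps <= (K * Phio eps)%:E)%E.
Proof.
move=> e10; pose Q := 2 * L1 * (8 * expR (1 / 3) + B0).
have Q0 : 0 <= Q.
  apply: mulr_ge0; first by rewrite mulr_ge0// ltW.
  by apply: addr_ge0 => //; rewrite mulr_ge0// expR_ge0.
exists ((e1^-1 * Q + b0) / (e1 * L1)).
  have h : 0 <= e1^-1 * Q by rewrite mulr_ge0// invr_ge0 ltW.
  have h' : 0 < e1 * L1 by rewrite mulr_gt0.
  by apply: divr_ge0; [exact: addr_ge0|exact: ltW].
move=> tau eps e1e G1 [tau0 tau_ge]; have e0 : 0 < eps by exact: lt_le_trans e1e.
have := @risk_le_crude R th eta lam tau Cl eps d b0 (bias th eta) lam0 tau0 e0 d0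
  tau_ge (Lam_le e0 G1) (sum_sqr_le_bias cvgb)
  (fun k => bias_nincr cvgb (leq0n k)) G1.
move=> /le_trans; apply; rewrite lee_fin -/B0 -/L1 -/Q.
have P1 : e1 * L1 <= Phio eps.
  apply: (@le_trans _ _ (eps * L1)); first by rewrite ler_wpM2r// ltW.
  exact: (Phio_ge th eta lam0 hE e0).
apply: (@le_trans _ _ (e1^-1 * Q + b0)).
  rewrite lerD2r ler_wpM2r//.
  have [_ h] := Geps_spec e0 G1; apply: le_trans h _.
  by rewrite lef_pV2.
rewrite -mulrA ler_peMr//.
  by rewrite addr_ge0// mulr_ge0// invr_ge0 ltW.
by rewrite mulrC ler_pdivlMr ?mul1r ?mulr_gt0.
Qed.

Lemma risk_le_small_noise (kappa : R) : 0 < kappa ->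
  exists2 K : R, 0 <= K & forall tau eps, 0 < eps <= 1 -> (mo eps <= G eps)%N ->
    kappa * Phio eps <= eps * (mo eps)%:R * Lbar lam (mo eps) ->
    (G eps)%:R * expR (- (mo eps)%:R) <= Phio eps ->
    tau_cond eps tau ->
    (risk th eta lam tau Cl eps <= (K * Phio eps)%:E)%E.
Proof.
move=> k0.
pose s0 := d / (1 + d).
have s00 : 0 < s0 by rewrite divr_gt0// addr_gt0.
(* [D] makes [s0 * ((D - 1) * m / Ll) / 32] equal to [(7 / 6 + 3 * Cl / 16) * m], the signal
   demanded by [risk_le_concentration]. *)
pose D := 1 + 32 * (7 / 6 + 3 * Cl / 16) * Ll / s0.
have D1 : 1 <= D.
  rewrite /D lerDl; have := C0; have := Ll0 => ? ?.
  by rewrite divr_ge0 ?(ltW s00)// mulr_ge0 ?(ltW Ll0)//; lra.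
(* Since [Cl >= 1], the net drift per extra dimension is at most [1 / 6 - 3 / 16 = - 1 / 48]. With
   [k - m >= (96 + 6 * Cl / kappa) * m] it cancels the signal term [Cl * m / kappa / 8] and leaves
   [- 2 * m]. *)
pose c := (Num.truncn (97 + 6 * Cl / kappa)).+1.
have cP : 97 + 6 * Cl / kappa <= c%:R by apply: ltW; exact: truncnS_gt.
pose X := 8 * expR (1 / 3) + B0.
have X0 : 0 <= X by apply: addr_ge0 => //; rewrite mulr_ge0// expR_ge0.
pose Y := 2 * L1 * (8 + B0) * expR (1 / 3).
have Y0 : 0 <= Y.
  rewrite /Y; apply: mulr_ge0; last exact: expR_ge0.
  by apply: mulr_ge0; [rewrite mulr_ge0// ltW|exact: addr_ge0].
pose Z := b0 * expR (1 / 3).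
have Z0 : 0 <= Z by rewrite mulr_ge0// expR_ge0.
pose W := c%:R * Lmax lam c * Ll.
have W0 : 0 <= W by rewrite mulr_ge0 ?(ltW Ll0)// mulr_ge0 ?Lmax_ge0.
exists (2 * W * X + Y * (b0 + L1) + D + Z).
  have := mulr_ge0 W0 X0; have h : 0 <= b0 + L1 by rewrite addr_ge0// ltW.
  have := mulr_ge0 Y0 h; lra.
move=> tau eps /andP[e0 e1] mG kP GP [tau0 tau_ge].
have [m1 mmin _] := mo_spec th eta lam0 hE e0; rewrite -/(mo eps) in m1 mmin.
have PE : Phio eps = Phi th eta lam eps (mo eps) by exact: (Phio_mo th eta lam0 hE).
have P0 : 0 < Phio eps by exact: (Phio_gt0 th eta lam0 hE).
have Ple : Phio eps <= b0 + L1 by apply: (Phio_le lam0 cvgb hE); rewrite e0.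
have bm : bias th eta (mo eps) <= Phio eps by rewrite PE le_max lexx.
have vm : eps * (mo eps)%:R * Lbar lam (mo eps) <= Phio eps.
  by rewrite PE le_max lexx orbT.
move: (mo eps) (Phio eps) m1 mG P0 Ple bm vm kP GP {mmin PE}.
move=> m P m1 mG P0 Ple bm vm kP GP.
have G1 : (1 <= G eps)%N by exact: leq_trans mG.
have mP : 1 <= m%:R :> R by rewrite ler1n.
have W1 : \sum_(1 <= j < (Geps lam eps).+1 | (j <= c * m)%N) eps * Lam lam j <= W * P.
  apply: le_trans (variance_range_le lam0 hE _ e0 (ltn0Sn _) m1) _.
  by rewrite ler_wpM2l.
have V1 k : (1 <= k <= Geps lam eps)%N -> D * P < bias th eta k -> (k <= m)%N /\
     m%:R + m%:R / 6 + 3 * Cl * m%:R / 16 <=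
     d / (1 + d) * (\sum_(k.+1 <= i < m.+1) zbias th eta lam eps i ^+ 2) / 32.
  move=> /andP[k1 kG] bk.
  have DP : P <= D * P by rewrite ler_peMl// ltW.
  have km : (k <= m)%N.
    rewrite leqNgt; apply/negP => mk.
    have := bias_nincr cvgb (ltnW mk); lra.
  split => //.
  have km' : (1 <= k <= m)%N by rewrite k1.
  have := sum_zbias_below lam0 cvgb hE e0 P0 D1 km' bm vm (ltW bk).
  move=> /(ler_wpM2l (ltW s00)); rewrite -/s0; apply: contraTT.
  rewrite -!ltNge; set S := \sum_(_ <= _ < _) _ => h.
  have -> : s0 * ((D - 1) * m%:R / Ll) = 32 * (7 / 6 + 3 * Cl / 16) * m%:R.
    by rewrite /D; field; rewrite !gt_eqF.
  lra.
have HM k : (c * m < k <= Geps lam eps)%N ->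
    Cl * m%:R / kappa / 8 + (k%:R - m%:R) / 6 - 3 * Cl * (k%:R - m%:R) / 16
      <= - (2 * m%:R).
  move=> /andP[ck _].
  have ck' : c%:R * m%:R <= k%:R :> R by rewrite -natrM ler_nat ltnW.
  have h1 : (97 + 6 * Cl / kappa) * m%:R <= k%:R by apply: le_trans ck'; rewrite ler_wpM2r.
  set q := Cl / kappa in h1 *.
  have q0 : 0 < q by rewrite divr_gt0.
  have -> : Cl * m%:R / kappa = q * m%:R by rewrite mulrAC.
  have h2 : 6 * Cl / kappa = 6 * q by rewrite mulrA.
  rewrite h2 in h1.
  have qm : 0 < q * m%:R by rewrite mulr_gt0// ltr0n.
  have km : 0 <= k%:R - m%:R :> R by lra.
  have h3 : 0 <= (Cl - 1) * (k%:R - m%:R) by rewrite mulr_ge0// subr_ge0.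
  lra.
have mcm : (m <= c * m)%N by rewrite leq_pmull.
have mG' : (1 <= m <= Geps lam eps)%N by rewrite m1.
have V0 : 0 <= D * P by rewrite mulr_ge0 ?(ltW P0)// (le_trans ler01 D1).
have := @risk_le_concentration R th eta lam tau Cl eps d b0 (bias th eta) lam0
  tau0 e0 d0 tau_ge (Lam_le e0 G1) (sum_sqr_le_bias cvgb)
  (fun k => bias_nincr cvgb (leq0n k)) G1 m (c * m)%N _ _ _ mG' mcm (ltW C0) V0
  (fun n => sum_zbias_above lam0 cvgb hE n e0 k0 m1 bm kP) HM V1 W1.
move=> /le_trans; apply; rewrite lee_fin -/B0 -/L1 -/X -/(G eps).
set g := (G eps)%:R in GP *; set q := expR (- m%:R) in GP *.
have -> : expR (- (2 * m%:R)) = q * q :> R by rewrite /q -expRD; congr expR; ring.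
have gq0 : 0 <= g * q by rewrite mulr_ge0 ?expR_ge0.
(* The double sum costs [g] twice, matched by [q] twice: one factor [g * q] is bounded by the rate,
   the other by a constant. *)
have h1 : (g * q) * (g * q) <= (b0 + L1) * P.
  by apply: ler_pM => //; exact: le_trans GP Ple.
have h2 := ler_wpM2l Y0 h1; have h3 := ler_wpM2l Z0 GP.
have -> : g * (g * (2 * L1 * (8 + B0) * (expR (1 / 3) * (q * q))))
  = Y * (g * q * (g * q)) by rewrite /Y; ring.
have -> : g * (b0 * (expR (1 / 3) * q)) = Z * (g * q) by rewrite /Z; ring.
lra.
Qed.

End oracle_bound.

Theorem mainTheorem14 (R : realType) (th eta lam : nat -> R)
    (d Cl Ll eps_o eps_th : R) :
  (exists B : R, forall j, `|lam j| <= B) ->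
  (forall j, (1 <= j)%N -> lam j != 0) ->
  cvgn (fun n => \sum_(1 <= j < n) th j ^+ 2) ->
  cvgn (fun n => \sum_(1 <= j < n) (th j - eta j) ^+ 2) ->
  0 < d ->
  AssumptionE lam Cl Ll ->
  0 < eps_o < 1 ->
  AssumptionO th eta lam eps_o ->
  0 < eps_th < 1 ->
  (forall eps, 0 < eps < eps_th -> (mo th eta lam eps <= Geps lam eps)%N) ->
  (fun e => ln ((Geps lam e)%:R / Phio th eta lam e) / (mo th eta lam e)%:R)
      @ 0^'+ --> 0 ->
  exists K : R,
    forall tau : R -> nat -> R,
      (forall eps j, 0 < eps < 1 -> (1 <= j)%N -> 0 < tau eps j) ->
      AssumptionA lam tau d ->
      forall eps, 0 < eps < eps_th ->
        (risk th eta lam (tau eps) Cl eps <= (K * Phio th eta lam eps)%:E)%E.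
Proof.
move=> _ lam0 _ cvgb d0 hE /andP[eo0 _] hO /andP[_ et1] moG hlim.
have [kappa k0 kP] := AssumptionO_le lam0 cvgb hE hO.
have [e1 e10 e1P] := Geps_exp_le lam0 hE hlim.
(* Below [e2] both the limit hypothesis and Assumption O are available; from [e2] on the noise is
   bounded away from 0. Both constants are fixed before [tau] is introduced. *)
pose e2 := Num.min e1 eps_o.
have e20 : 0 < e2 by rewrite lt_min e10.
have [K1 K10 K1P] := risk_le_small_noise lam0 cvgb hE d0 k0.
have [K2 K20 K2P] := risk_le_noise_away lam0 cvgb hE d0 e20.
exists (K1 + K2) => tau tau0 hA eps /andP[e0 et].
have eps1 : 0 < eps < 1 by rewrite e0 (lt_trans et).
have mG := moG eps; rewrite e0 et in mG; have {}mG := mG isT.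
have [m1 _ _] := mo_spec th eta lam0 hE e0.
have G1 : (1 <= Geps lam eps)%N by exact: leq_trans mG.
have P0 := Phio_gt0 th eta lam0 hE e0.
have taus := conj (fun j => tau0 eps j eps1) (hA eps eps1).
have [ee2|e2e] := ltP eps e2.
  move: ee2; rewrite lt_min => /andP[ee1 eeo].
  apply: (@le_trans _ _ (K1 * Phio th eta lam eps)%:E).
    apply: K1P => //.
    - by rewrite e0 ltW// (lt_trans et).
    - by apply: kP; rewrite e0.
    - by apply: e1P => //; rewrite e0.
  by rewrite lee_fin ler_wpM2r ?(ltW P0)// lerDl.
apply: (@le_trans _ _ (K2 * Phio th eta lam eps)%:E).
  exact: K2P.
by rewrite lee_fin ler_wpM2r ?(ltW P0)// lerDr.
Qed.
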